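(* Consider an arbitrary (multichain) average-reward MDP $(\mathcal{S},\mathcal{A},P,r)$ with finite $\mathcal{S},\mathcal{A}$, let $\alpha\in(0,1/|\mathcal{A}|)$, $\mu\in\mathcal{M}_+(\mathcal{S})$ and $\pi_0\in\Pi_\alpha$. Then the $\alpha$-clipped policy mirror ascent with constant step size $\eta_k=\eta>0$ started at $\pi_0$ generates a sequence of policies $\{\pi_k\}$ satisfying, for every $k$, $$J_\mu^{\pi_\alpha}-J_\mu^{\pi_k}\le\frac{1}{k+1}\left(\frac{D_{\rho_\mu^{\pi_\alpha}}(\pi_\alpha,\pi_0)}{\eta}+C_\alpha\big(J_\mu^{\pi_\alpha}-J_\mu^{\pi_0}\big)\right),$$ where $\pi_\alpha\in\arg\max_{\pi\in\Pi_\alpha}J_\mu^\pi$.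
   Context: MDP. $(\mathcal{S},\mathcal{A},P,r)$ has finite state space $\mathcal{S}$, finite action space $\mathcal{A}$, transition kernel $P:\mathcal{S}\times\mathcal{A}\to\mathcal{M}(\mathcal{S})$ and reward $r:\mathcal{S}\times\mathcal{A}\to[-R,R]$; $\mathcal{M}(X)$ is the set of probability distributions on $X$ and $\mathcal{M}_+(X)$ those with full support. ''Multichain'' means general: no structural assumption. A policy is $\pi:\mathcal{S}\to\mathcal{M}(\mathcal{A})$; $\Pi$ is the set of all policies, $\Pi_+=\{\pi\in\Pi:\pi(a\mid s)>0\ \forall s,a\}$, $\Pi_\alpha=\{\pi\in\Pi:\pi(a\mid s)\ge\alpha\ \forall s,a\}$, $\mathcal{M}_\alpha(\mathcal{A})=\{p\in\mathcal{M}(\mathcal{A}):p(a)\ge\alpha\ \forall a\}$. For a policy $\pi$: $r^\pi(s)=\sum_a\pi(a\mid s)r(s,a)$, $P^\pi(s,s')=\sum_a\pi(a\mid s)P(s'\mid s,a)$, $P^\pi_\star=\lim_{H\to\infty}\frac1H\sum_{i=0}^{H-1}(P^\pi)^i$ (exists), $(Pf)(s,a)=\sum_{s'}P(s'\mid s,a)f(s')$. Values. Average reward $J^\pi(s)=\liminf_{H\to\infty}\frac1H\mathbb{E}_\pi[\sum_{h=0}^{H-1}r(s_h,a_h)\mid s_0=s]$, i.e. $J^\pi=P^\pi_\star r^\pi$; $J^\pi_\mu=\sum_s\mu(s)J^\pi(s)$; $V^\pi=(I-P^\pi+P^\pi_\star)^{-1}(I-P^\pi_\star)r^\pi$, $K^\pi=PJ^\pi$,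 $Q^\pi=r+PV^\pi-K^\pi$. State classification. A state is recurrent under $\pi$ if the chain $P^\pi$ started there returns with probability $1$, transient otherwise. The decomposition of $\mathcal{S}$ into transient states $\mathcal{T}$ and recurrent classes $\mathcal{R}_1,\dots,\mathcal{R}_m$ is the same for all $\pi\in\Pi_+$; $\mathcal{T}$ and $\mathcal{R}=\bigcup_i\mathcal{R}_i$ denote these fixed sets. Visitation measures. For $\pi\in\Pi_+$: $d^\pi_\mu(s)=\sum_{s_0}\mu(s_0)P^\pi_\star(s_0,s)$; $\bar T^\pi(s_1,s_2)=P^\pi(s_1,s_2)$ if $s_1,s_2\in\mathcal{T}$, else $0$; $\delta^\pi_\mu(s)=\sum_{s_0}\mu(s_0)\big((I-\bar T^\pi)^{-1}\big)(s_0,s)$; $\rho^\pi_\mu(s)=d^\pi_\mu(s)\mathbf{1}_{\mathcal{R}}(s)+\delta^\pi_\mu(s)\mathbf{1}_{\mathcal{T}}(s)$. Set $C_\alpha=\max_{s\in\mathcal{S},\,\pi,\pi'\in\Pi_\alpha}\rho^\pi_\mu(s)/\rho^{\pi'}_\mu(s)$, which is finite. The maximizer $\pi_\alpha$ exists. Bregman divergence. $h:\mathcal{M}(\mathcal{A})\to\mathbb{R}$ is strictly convex and continuously differentiable on the relative interior of $\mathcal{M}(\mathcal{A})$; $D(p,p')=h(p)-h(p')-\langle\nabla h(p'),p-p'\rangle$ for $p\in\mathcal{M}(\mathcal{A})$ and $p'$ in the relative interior. For $\rho\in\mathbb{R}_+^{|\mathcal{S}|}$, $D_\rho(\pi,\pi')=\sum_s\rho(s)D(\pi(\cdot\mid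 s),\pi'(\cdot\mid s))$. Algorithm ($\alpha$-clipped policy mirror ascent). With $G^\pi(s,a)=Q^\pi(s,a)\mathbf{1}_{\mathcal{R}}(s)+K^\pi(s,a)\mathbf{1}_{\mathcal{T}}(s)$, from $\pi_0\in\Pi_\alpha$ and step sizes $\eta_k>0$, for $k\ge0$ and every $s\in\mathcal{S}$: $$\pi_{k+1}(\cdot\mid s)=\arg\max_{p\in\mathcal{M}_\alpha(\mathcal{A})}\Big\{\eta_k\sum_{a}G^{\pi_k}(s,a)p(a)-D\big(p,\pi_k(\cdot\mid s)\big)\Big\}.$$ *)

(* Defs.v *)
(* MathComp / MathComp-Analysis *)
From HB Require Import structures.
From mathcomp Require Import all_boot all_order all_algebra.
From mathcomp Require Import all_classical all_reals all_analysis.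

Set Implicit Arguments.
Unset Strict Implicit.
Unset Printing Implicit Defensive.

Import Order.TTheory GRing.Theory Num.Theory.
Import numFieldNormedType.Exports.

Local Open Scope classical_set_scope.
Local Open Scope ring_scope.

(* Conventions: states are 'I_n, actions are 'I_m, and a distribution or a
   function on a finite set of size k is a row vector 'rV[R]_k. *)

Section Simplex.
Context {R : realType} {k : nat}.
Implicit Types (p q g : 'rV[R]_k) (alpha : R).

Definition dot g p : R := \sum_i g 0 i * p 0 i.

Definition simplex : set 'rV[R]_k :=
  [set p | (forall i, 0 <= p 0 i) /\ \sum_i p 0 i = 1].

Definition simplex_pos : set 'rV[R]_k :=
  [set p | simplex p /\ forall i, 0 < p 0 i].

Definition simplex_ge alpha : set 'rV[R]_k :=
  [set p | simplex p /\ forall i, alpha <= p 0 i].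

Definition simplex_hull : set 'rV[R]_k := [set p | \sum_i p 0 i = 1].

(* The interior of the simplex relative to its affine hull. *)
Definition simplex_relint : set 'rV[R]_k :=
  [set p | simplex p /\ \forall q \near p, simplex_hull q -> simplex q].

End Simplex.

Section Bregman.
Context {R : realType} {m : nat}.
Implicit Types (h : 'rV[R]_m -> R) (gradh : 'rV[R]_m -> 'rV[R]_m).

Definition strictly_convex_on (A : set 'rV[R]_m) h : Prop :=
  forall p q (t : R), A p -> A q -> p != q -> 0 < t < 1 ->
    h (t *: p + (1 - t) *: q) < t * h p + (1 - t) * h q.

(* g is a gradient of h at p relative to the simplex: only the values of h on
   the simplex are used. Such a g is unique up to a multiple of the all-ones
   vector, which is orthogonal to every difference of two distributions. *)
Definition gradient_at h (p g : 'rV[R]_m) : Prop :=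
  forall e : R, 0 < e -> \forall q \near p, simplex q ->
    `|h q - h p - dot g (q - p)| <= e * `|q - p|.

Definition C1_relint h gradh : Prop :=
  (forall p, simplex_relint p -> gradient_at h p (gradh p)) /\
  {within simplex_relint, continuous gradh}.

Definition bregman h gradh (p p' : 'rV[R]_m) : R :=
  h p - h p' - dot (gradh p') (p - p').

End Bregman.

Definition argmax {R : realType} {T : Type} (A : set T) (f : T -> R) : set T :=
  [set x | A x /\ forall y, A y -> f y <= f x].

Record mdp (R : realType) (n m : nat) := MDP {
  kernel : 'I_n -> 'I_m -> 'rV[R]_n;
  reward : 'I_n -> 'I_m -> R;
  rbound : R;
  kernel_simplex : forall s a, simplex (kernel s a);
  reward_bounded : forall s a, - rbound <= reward s a <= rbound
}.

Section MarkovChain.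
Context {R : realType} {n : nat}.
Implicit Types (P : 'M[R]_n) (s t : 'I_n).

Definition cesaro_limit P : 'M[R]_n :=
  lim ((fun H : nat => H%:R^-1 *: \sum_(i < H) P ^+ i) @ \oo).

(* Probability that the chain started at s visits t at time k.+1 and at no time
   in {1, ..., k}. *)
Fixpoint first_passage P t (k : nat) s : R :=
  if k is k'.+1 then \sum_(u | u != t) P s u * first_passage P t k' u
  else P s t.

Definition recurrent P s : Prop :=
  (fun N : nat => \sum_(k < N) first_passage P s k s) @ \oo --> (1 : R).

End MarkovChain.

Section AverageReward.
Context {R : realType} {n m : nat}.
Variable M : mdp R n m.

Definition policy := 'I_n -> 'rV[R]_m.
Implicit Types (pi : policy) (mu : 'rV[R]_n) (s : 'I_n) (a : 'I_m).

Definition policies : set policy := [set pi | forall s, simplex (pi s)].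
Definition policies_pos : set policy := [set pi | forall s, simplex_pos (pi s)].
Definition policies_ge (alpha : R) : set policy :=
  [set pi | forall s, simplex_ge alpha (pi s)].

Definition reward_pi pi : 'cV[R]_n := \col_s \sum_a pi s 0 a * reward M s a.

Definition kernel_pi pi : 'M[R]_n :=
  \matrix_(s, s') \sum_a pi s 0 a * kernel M s a 0 s'.

Definition Pstar pi : 'M[R]_n := cesaro_limit (kernel_pi pi).

(* Law of the trajectory (s_0, a_0), (s_1, a_1), ... when s_0 ~ nu, a_h ~ pi s_h
   and s_{h+1} ~ kernel M s_h a_h. *)
Fixpoint traj_prob pi (nu : 'rV[R]_n) (tau : seq ('I_n * 'I_m)) : R :=
  if tau is (s, a) :: tau' then
    nu 0 s * pi s 0 a * traj_prob pi (kernel M s a) tau'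
  else 1.

Definition expected_return pi (H : nat) s : R :=
  \sum_(tau : H.-tuple ('I_n * 'I_m))
    traj_prob pi (delta_mx 0 s) tau * \sum_(x <- tau) reward M x.1 x.2.

Definition Jval pi s : R :=
  limn_inf (fun H : nat => H%:R^-1 * expected_return pi H s).

Definition Jmu mu pi : R := \sum_s mu 0 s * Jval pi s.

Definition Vval pi : 'cV[R]_n :=
  invmx (1%:M - kernel_pi pi + Pstar pi) *m (1%:M - Pstar pi) *m reward_pi pi.

Definition Kval pi s a : R := \sum_s' kernel M s a 0 s' * Jval pi s'.

Definition Qval pi s a : R :=
  reward M s a + \sum_s' kernel M s a 0 s' * Vval pi s' 0 - Kval pi s a.

(* The classification does not depend on the choice of pi with full support. *)
Definition recurrent_state : pred 'I_n := fun s =>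
  `[< forall pi, policies_pos pi -> recurrent (kernel_pi pi) s >].
Definition transient_state : pred 'I_n := fun s => ~~ recurrent_state s.

Definition dvisit mu pi s : R := \sum_s0 mu 0 s0 * Pstar pi s0 s.

Definition kernel_transient pi : 'M[R]_n :=
  \matrix_(s1, s2) (if transient_state s1 && transient_state s2
                    then kernel_pi pi s1 s2 else 0).

Definition tvisit mu pi s : R :=
  \sum_s0 mu 0 s0 * invmx (1%:M - kernel_transient pi) s0 s.

Definition rho mu pi s : R :=
  dvisit mu pi s * (recurrent_state s)%:R +
  tvisit mu pi s * (transient_state s)%:R.

(* The supremum is finite and attained when mu has full support and
   0 < alpha < 1/m, so it is a maximum. *)
Definition Calpha mu (alpha : R) : R :=
  sup [set c | exists s pi pi', [/\ policies_ge alpha pi,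
         policies_ge alpha pi' & c = rho mu pi s / rho mu pi' s]].

Definition Gval pi s a : R :=
  Qval pi s a * (recurrent_state s)%:R + Kval pi s a * (transient_state s)%:R.

Definition bregman_weighted (h : 'rV[R]_m -> R) (gradh : 'rV[R]_m -> 'rV[R]_m)
    (w : 'I_n -> R) pi pi' : R :=
  \sum_s w s * bregman h gradh (pi s) (pi' s).

Definition clipped_mirror_ascent (h : 'rV[R]_m -> R)
    (gradh : 'rV[R]_m -> 'rV[R]_m) (alpha : R) (eta : nat -> R)
    (pi0 : policy) (pis : nat -> policy) : Prop :=
  pis 0 = pi0 /\
  forall (k : nat) s,
    argmax (simplex_ge alpha)
      (fun p => eta k * \sum_a Gval (pis k) s a * p 0 a
                - bregman h gradh p (pis k s))
      (pis k.+1 s).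

End AverageReward.

Arguments policies {R n m}.
Arguments policies_pos {R n m}.
Arguments policies_ge {R n m} alpha.

(* Main.v *)
Require Import Defs.
From HB Require Import structures.
From mathcomp Require Import all_boot all_order all_algebra.
From mathcomp Require Import all_classical all_reals all_analysis.
From mathcomp Require Import ring lra.

Set Implicit Arguments.
Unset Strict Implicit.
Unset Printing Implicit Defensive.

Import Order.TTheory GRing.Theory Num.Theory.
Import numFieldNormedType.Exports.

Local Open Scope classical_set_scope.
Local Open Scope ring_scope.

(** The proof follows the usual analysis of mirror ascent, in which the
    performance difference identity replaces concavity of the objective.

    [performance_difference]: for policies pi, pi' with full support,
    Jmu pi' - Jmu pi is the sum over s of rho pi' s times the scalar product of
    Gval pi s with pi' s - pi s. It rests on the classification of states: both
    policies have the same recurrent classes, J is constant on each of them, and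
    the transient part of the chain is eventually left.

    [proximal_three_point]: the update maximizes a linear form minus a Bregman
    divergence, so against every competitor p the linear form loses at most a
    difference of divergences to p. With p the current policy, the advantage of
    the next policy is nonnegative at each state, hence Jmu increases along the
    iterates. With p the optimal policy, weighted by rho of that policy, and after
    replacing this weight by Calpha times rho of the next policy (which is
    legitimate because the advantages are nonnegative), the gap of the current
    policy is at most Calpha times the increase of Jmu in this step, plus a
    telescoping difference of divergences over eta ([mirror_step_gap]). Summing
    over the first k + 1 steps and bounding each gap from below by the last one
    gives the rate.

    Three facts need more than algebra. The Cesaro limit of a stochastic matrix P
    exists because the space is the direct sum of ker (1 - P) and im (1 - P).
    Recurrence, which is defined by return probabilities, only depends on the
    transition graph ([recurrentP]), by the minimum principle. The supremum
    Calpha is finite because rho lies between two positive constants on all the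
    policies that give each action at least the probability alpha
    ([rho_bounds]): transition probabilities are bounded below uniformly in the
    policy, and such bounds propagate along paths of the transition graph. *)

(** * Reachability and the minimum principle *)

Lemma connect_invariant (T : finType) (e : rel T) (Q : T -> Prop) x :
  Q x -> (forall y z, connect e x y -> Q y -> e y z -> Q z) ->
  forall y, connect e x y -> Q y.
Proof.
move=> Qx Qe y /connectP[p]; elim/last_ind: p y => [|p z IH] y /=; first by move=> _ ->.
rewrite rcons_path last_rcons => /andP[xp ez] ->.
have xl : connect e x (last x p) by apply/connectP; exists p.
by apply: Qe xl _ ez; apply: IH.
Qed.

(** The graph form of recurrence: the strong component of s is closed. *)
Definition essential (T : finType) (e : rel T) s :=
  forall u, connect e s u -> connect e u s.

Lemma essential_connect (T : finType) (e : rel T) s u :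
  essential e s -> connect e s u -> essential e u.
Proof.
by move=> es su v uv; apply: connect_trans (es v (connect_trans su uv)) su.
Qed.

Lemma eq_essential (T : finType) (e e' : rel T) s :
  e =2 e' -> essential e s <-> essential e' s.
Proof.
move=> ee'; have cc' := eq_connect ee'.
by split=> ess u; [rewrite -!cc'|rewrite !cc']; exact: ess.
Qed.

(** A vertex with the smallest reachable set is essential: moving along an edge
    can only shrink this set. *)
Lemma exists_essential (T : finType) (e : rel T) x :
  exists2 u, connect e x u & essential e u.
Proof.
have [u xu umin] := arg_minnP (fun u => #|connect e u|) (connect0 e x).
exists u => // w uw.
have sub : connect e w \subset connect e u.
  by apply/fintype.subsetP => z wz; apply: connect_trans uw wz.
have le : (#|connect e u| <= #|connect e w|)%N.
  by apply: umin; apply: connect_trans xu uw.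
have /subset_cardP eqs : #|connect e w| = #|connect e u|.
  by apply/eqP; rewrite eqn_leq le subset_leq_card.
by have := eqs sub u; rewrite /in_mem /= connect0.
Qed.

Section Stochastic.
Context {R : realType} {n : nat}.
Implicit Types (P : 'M[R]_n) (s t u x y z : 'I_n).

Definition stochastic P :=
  (forall x y, 0 <= P x y) /\ forall x, \sum_y P x y = 1.

Definition step P : rel 'I_n := fun x y => 0 < P x y.

(** An average of values that are at least f x only reaches f x when all of them
    are f x, so that a minimum spreads along edges. Superharmonicity is asked only
    where the minimum is attained: this lets the principle apply to functions
    that are truncated at other states. *)
Lemma minimum_principle P (f : 'I_n -> R) x : stochastic P ->
  (forall y, connect (step P) x y -> f x <= f y) ->
  (forall y, connect (step P) x y -> f y = f x ->
     \sum_u P y u * f u <= f y) ->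
  forall y, connect (step P) x y -> f y = f x.
Proof.
move=> [P0 P1] fmin fsup; apply: connect_invariant => // y z xy fy yz.
have term_ge0 u : 0 <= P y u * (f u - f x).
  have := P0 y u; rewrite le_eqVlt => /orP[/eqP <-|yu]; first by rewrite mul0r.
  rewrite mulr_ge0 ?P0// subr_ge0 fmin//.
  exact: connect_trans xy (connect1 yu).
have sum0 : \sum_u P y u * (f u - f x) = 0.
  apply/eqP; rewrite eq_le sumr_ge0 ?andbT//.
  under eq_bigr do rewrite mulrBr.
  by rewrite sumrB -mulr_suml P1 mul1r subr_le0 -fy fsup.
have /eqP := psumr_eq0P (fun u _ => term_ge0 u) sum0 (i := z) isT.
by rewrite mulf_eq0 gt_eqF//= subr_eq0 => /eqP.
Qed.

Lemma le1_stochastic P x y : stochastic P -> P x y <= 1.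
Proof.
move=> [P0 P1]; rewrite -(P1 x) (bigD1 y)//= lerDl.
by apply: sumr_ge0 => u _.
Qed.

(** A lower bound that loses a factor c at each step loses at most c ^+ n along
    any path, since a shortest path does not repeat a state. *)
Lemma path_decay (e : rel 'I_n) (c : R) (w : 'I_n -> R) x y :
  0 <= c <= 1 -> (forall u, 0 <= w u) ->
  (forall u v, e u v -> c * w u <= w v) ->
  connect e x y -> c ^+ n * w x <= w y.
Proof.
move=> /andP[c0 c1] w0 we /connectP[p ep ->].
have [q eq uq _] := shortenP ep.
have le_size : (size q <= n)%N.
  by have := max_card (mem (x :: q)); rewrite card_ord (card_uniqP uq) => /ltnW.
apply: (@le_trans _ _ (c ^+ size q * w x)).
  by rewrite ler_wpM2r// ler_wiXn2l.
clear -eq c0 we; elim: q x eq => [|z q IH] x /=; first by rewrite mul1r.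
move=> /andP[/we xz zq]; rewrite exprSr -mulrA.
by apply: le_trans (IH _ zq); rewrite ler_wpM2l// exprn_ge0.
Qed.

End Stochastic.

(** * Recurrence is a property of the transition graph *)

Lemma cvg_finsum (R : realType) (T : Type) (U : set_system T) (FU : Filter U)
    (I : Type) (r : seq I) (Q : pred I) (F : I -> T -> R) (l : I -> R) :
  (forall i, F i @ U --> l i) ->
  (fun k => \sum_(i <- r | Q i) F i k) @ U --> \sum_(i <- r | Q i) l i.
Proof.
move=> Fl; elim: r => [|i r IH].
  by under eq_fun do rewrite big_nil; rewrite big_nil; exact: cvg_cst.
rewrite big_cons; under eq_fun do rewrite big_cons.
by case: (Q i) => //; apply: cvgD.
Qed.

Lemma limit_unique (R : realType) (f : nat -> R) (a b : R) :
  f @ \oo --> a -> f @ \oo --> b -> a = b.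
Proof. by move=> fa fb; apply: cvg_unique fa fb; exact: Rhausdorff. Qed.

Section Recurrence.
Context {R : realType} {n : nat}.
Variables (P : 'M[R]_n).
Hypothesis stochP : stochastic P.
Implicit Types s t u x y z : 'I_n.

(* The probability of visiting t at one of the times 1, ..., N. *)
Let hit t N x : R := \sum_(k < N) first_passage P t k x.

Let hitS t N x : hit t N.+1 x = P x t + \sum_(u | u != t) P x u * hit t N u.
Proof.
rewrite /hit big_ord_recl /=; congr (_ + _).
under [RHS]eq_bigr do rewrite mulr_sumr.
by rewrite [RHS]exchange_big.
Qed.

Let first_passage_ge0 t k x : 0 <= first_passage P t k x.
Proof.
have [P0 _] := stochP.
elim: k x => [|k IH] x /=; first exact: P0.
by apply: sumr_ge0 => u _; rewrite mulr_ge0.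
Qed.

Let hit_le1 t N x : hit t N x <= 1.
Proof.
have [P0 P1] := stochP.
elim: N x => [|N IH] x; first by rewrite /hit big_ord0.
rewrite hitS -(P1 x) [leRHS](bigD1 t)//= lerD2l; apply: ler_sum => u _.
by rewrite ler_piMr.
Qed.

Let ret t x : R := limn (fun N => hit t N x).

Let hit_cvg t x : (fun N => hit t N x) @ \oo --> ret t x.
Proof.
apply: nondecreasing_is_cvgn; last by exists 1 => _ [N _ <-]; exact: hit_le1.
apply/nondecreasing_seqP => N.
by rewrite /hit big_ord_recr /= lerDl; exact: first_passage_ge0.
Qed.

Let ret_le1 t x : ret t x <= 1.
Proof. by apply: cvgr_to_le (@hit_cvg t x) _; apply: nearW => N; exact: hit_le1. Qed.

(* First-step analysis; on the right, a state hits itself with probability 1. *)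
Let retE t x : ret t x = \sum_u P x u * (if u == t then 1 else ret t u).
Proof.
rewrite (bigD1 t)//= eqxx mulr1.
apply: (@limit_unique _ (fun N => hit t N.+1 x)).
  by rewrite (cvg_shiftS (fun N => hit t N x)); exact: hit_cvg.
under eq_fun do rewrite hitS.
apply: cvgD; first exact: cvg_cst.
have -> : \sum_(u < n | u != t) P x u * (if u == t then 1 else ret t u) =
    \sum_(u < n | u != t) P x u * ret t u.
  by apply: eq_bigr => u /negbTE ->.
by apply: cvg_finsum => u; apply: cvgMr; exact: hit_cvg.
Qed.

(** If s is recurrent, then the return probability attains its maximum 1 at s,
    so by the minimum principle it is 1 at all states reached from s, whereas it
    is 0 at those that do not lead to s. Conversely, on a closed strong component
    the hitting probability of s cannot attain a minimum below 1: that value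
    would spread to s itself. *)
Theorem recurrentP s : recurrent P s <-> essential (step P) s.
Proof.
split=> [rec u su|ess].
- have rets : ret s s = 1.
    exact: limit_unique (@hit_cvg s s) rec.
  have retu : - ret s u = - ret s s.
    apply: (@minimum_principle _ _ P (fun x => - ret s x) s) => //.
      by move=> y _; rewrite rets lerN2.
    move=> y _ _; under eq_bigr do rewrite mulrN.
    rewrite sumrN lerN2 [leLHS]retE; apply: ler_sum => z _.
    by case: eqP => // ->; rewrite rets.
  apply: contrapT => nus.
  have hit0 N : hit s N u = 0.
    rewrite /hit big1// => k _; elim: (k : nat) u {su retu} nus => [|j IH] x nxs /=.
      have [P0 _] := stochP; apply/eqP; rewrite eq_le P0 andbT leNgt.
      by apply/negP => xs; apply: nxs; apply: connect1.
    apply: big1 => y _; have [P0 _] := stochP.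
    have := P0 x y; rewrite le_eqVlt => /orP[/eqP <-|xy]; first by rewrite mul0r.
    rewrite IH ?mulr0// => ys; apply: nxs.
    exact: connect_trans (connect1 xy) ys.
  have : ret s u = 0.
    apply: (limit_unique (@hit_cvg s u)).
    by under eq_fun do rewrite hit0; exact: cvg_cst.
  by move=> ret0; move: retu; rewrite ret0 rets => /eqP; rewrite eqr_opp eq_sym oner_eq0.
- pose f u := if u == s then 1 else ret s u.
  have retf x : ret s x = \sum_u P x u * f u by rewrite retE.
  have [x sx xmin] := Order.TotalTheory.arg_minP f (connect0 (step P) s).
  have fx1 : 1 <= f x.
    rewrite leNgt; apply/negP => fx1.
    suff : f s = f x by move=> fs; move: fx1; rewrite -fs /f eqxx ltxx.
    apply: (@minimum_principle _ _ P f x) => // [y xy|y xy fy|]; last exact: ess.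
      by apply: xmin; apply: connect_trans sx xy.
    rewrite -retf; have -> // : f y = ret s y.
    by move: fx1; rewrite -fy /f; case: eqP; rewrite ?ltxx.
  suff ret1 : ret s s = 1 by have := @hit_cvg s s; rewrite ret1.
  apply/eqP; rewrite eq_le ret_le1 /= retf.
  have [P0 P1] := stochP; rewrite -[X in X <= _](P1 s); apply: ler_sum => u _.
  have := P0 s u; rewrite le_eqVlt => /orP[/eqP <-|su]; first by rewrite mul0r.
  rewrite ler_peMr// (le_trans fx1)//.
  by apply: xmin; apply: connect1.
Qed.

End Recurrence.

(** * Cesaro limits of stochastic matrices *)

Section CesaroLimit.
Context {R : realType} {n : nat}.
Implicit Types (P Q : 'M[R]_n) (f : 'cV[R]_n).

Lemma mulmx_stochastic P Q : stochastic P -> stochastic Q -> stochastic (P *m Q).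
Proof.
move=> [P0 P1] [Q0 Q1]; split=> [x y|x].
  by rewrite mxE sumr_ge0// => u _; rewrite mulr_ge0.
under eq_bigr do rewrite mxE.
rewrite exchange_big /= -(P1 x); apply: eq_bigr => u _.
by rewrite -mulr_sumr Q1 mulr1.
Qed.

Lemma exp_stochastic P k : stochastic P -> stochastic (P ^+ k).
Proof.
move=> Ps; elim: k => [|k IH]; last first.
  by rewrite exprS -mulmxE; exact: mulmx_stochastic.
rewrite expr0; split=> [x y|x]; first by rewrite mxE; case: eqP.
rewrite (bigD1 x)//= mxE eqxx big1 ?addr0// => y yx.
by rewrite mxE eq_sym (negbTE yx).
Qed.

Lemma cvg_matrix (p q : nat) (F : nat -> 'M[R]_(p, q)) (L : 'M[R]_(p, q)) :
  (forall i j, (fun k => F k i j) @ \oo --> L i j) -> F @ \oo --> L.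
Proof.
move=> FL; apply/cvgrPdist_le => e e0.
have near_all : \forall k \near \oo, forall ij : 'I_p * 'I_q,
    `|L ij.1 ij.2 - F k ij.1 ij.2| <= e.
  by apply: filter_forall => -[i j] /=; move/cvgrPdist_le : (FL i j); apply.
apply: filterS near_all => k near_k.
rewrite /Num.norm/= mx_normrE; apply: bigmax_le; first exact: ltW.
by move=> ij _; rewrite !mxE.
Qed.

Definition cesaro_mean P (H : nat) : 'M[R]_n := H%:R^-1 *: \sum_(i < H) P ^+ i.

Lemma geometric_sum P H : (1%:M - P) *m (\sum_(i < H) P ^+ i) = 1%:M - P ^+ H.
Proof.
elim: H => [|H IH]; first by rewrite big_ord0 mulmx0 expr0 subrr.
rewrite big_ord_recr /= mulmxDr IH mulmxBl mul1mx exprS -mulmxE.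
by rewrite addrA subrK.
Qed.

Lemma norm_mulmx_1Bexp P H p (v : 'M[R]_(p, n)) i j : stochastic P ->
  `|(v *m (1%:M - P ^+ H)) i j| <= \sum_k `|v i k|.
Proof.
move=> Ps; have [E0 E1] := exp_stochastic H Ps.
rewrite mxE (le_trans (ler_norm_sum _ _ _))//; apply: ler_sum => k _.
rewrite normrM ler_piMr// !mxE; have := le1_stochastic k j (exp_stochastic H Ps).
have := E0 k j; case: (k == j) => /= e0 e1.
  by rewrite ger0_norm ?subr_ge0// lerBlDr lerDl.
by rewrite sub0r normrN ger0_norm.
Qed.

(** A vector u = v (1 - P) fixed by P satisfies H u = v (1 - P ^+ H), which stays
    bounded, so u = 0. *)
Lemma capmx_ker_1B P : stochastic P ->
  (kermx (1%:M - P) :&: (1%:M - P))%MS = 0.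
Proof.
move=> Ps; apply/eqP/rowV0P => u.
rewrite sub_capmx => /andP[/sub_kermxP uD /submxP[v uv]].
have uP k : u *m P ^+ k = u.
  elim: k => [|k IH]; first by rewrite expr0 mulmx1.
  rewrite exprS -mulmxE mulmxA; suff -> : u *m P = u by [].
  by apply/esym/eqP; rewrite -subr_eq0 -{1}(mulmx1 u) -mulmxBr uD.
have Hu H : u *+ H = v *m (1%:M - P ^+ H).
  rewrite -geometric_sum mulmxA -uv mulmx_sumr.
  by under eq_bigr do rewrite uP; rewrite sumr_const card_ord.
apply/rowP => j; rewrite mxE; apply/eqP/negPn/negP => uj.
have uj0 : 0 < `|u 0 j| by rewrite normr_gt0.
set C := \sum_k `|v 0 k|.
have C0 : 0 <= C / `|u 0 j| by rewrite divr_ge0// sumr_ge0.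
have := archi_boundP C0; set k := Num.bound _.
rewrite ltr_pdivrMr// ltNge => /negP; apply.
apply: le_trans (norm_mulmx_1Bexp k v 0 j Ps).
by rewrite -Hu mulmxnE normrMn mulr_natl.
Qed.

(** Since ker (1 - P) and im (1 - P) meet trivially they span everything; the
    Cesaro means fix the former and are O(1/H) on the latter. *)
Lemma cesaro_mean_split P : stochastic P ->
  exists L Y : 'M[R]_n, L *m P = L /\
    forall H, cesaro_mean P H.+1 = L + H.+1%:R^-1 *: (Y *m (1%:M - P ^+ H.+1)).
Proof.
move=> Ps; set D := 1%:M - P.
have full : (1%:M <= kermx D + D)%MS.
  rewrite sub1mx /row_full; apply/eqP.
  have := mxrank_sum_cap (kermx D) D.
  by rewrite capmx_ker_1B// mxrank0 addn0 mxrank_ker => ->; rewrite subnK// rank_leq_row.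
have /sub_addsmxP[[X Y] /= XY] := full.
have kerP : kermx D *m P = kermx D.
  by apply/esym/eqP; rewrite -subr_eq0 -{1}(mulmx1 (kermx D)) -mulmxBr mulmx_ker.
have kerPk k : kermx D *m P ^+ k = kermx D.
  by elim: k => [|k IH]; rewrite ?expr0 ?mulmx1// exprS -mulmxE mulmxA kerP.
exists (X *m kermx D), Y; split=> [|H]; first by rewrite -mulmxA kerP.
rewrite -[LHS]mul1mx {1}XY mulmxDl /cesaro_mean -!scalemxAr; congr (_ + _).
  rewrite -mulmxA mulmx_sumr; under eq_bigr do rewrite kerPk.
  by rewrite sumr_const card_ord -[kermx D *+ _]scaler_nat -scalemxAr
    scalerA mulVf ?pnatr_eq0// scale1r.
by rewrite -mulmxA geometric_sum.
Qed.

Lemma cesaro_mean_cvg_fixed P : stochastic P ->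
  cesaro_mean P @ \oo --> cesaro_limit P /\ cesaro_limit P *m P = cesaro_limit P.
Proof.
move=> Ps; have [L [Y [LP HL]]] := cesaro_mean_split Ps.
suff cvgL : cesaro_mean P @ \oo --> L.
  rewrite /cesaro_limit -/(cesaro_mean P).
  suff -> : lim (cesaro_mean P @ \oo) = L by [].
  by apply/cvg_lim => //; exact: norm_hausdorff.
apply: cvg_matrix => i j; rewrite -(cvg_shiftS (fun k => cesaro_mean P k i j)) /=.
pose C := \sum_k `|Y i k|.
have cvg0 (c : R) : (fun k => L i j + c * harmonic k) @ \oo --> L i j.
  rewrite -[X in _ --> X]addr0 -[X in _ + X](mulr0 c).
  apply: cvgD; first exact: cvg_cst.
  by apply: cvgMr; exact: cvg_harmonic.
apply: squeeze_cvgr (cvg0 (- C)) (cvg0 C); apply: nearW => k.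
rewrite HL mxE mxE mulNr [C * _]mulrC -ler_distl addrAC subrr add0r normrM.
by rewrite ger0_norm ?invr_ge0// ler_wpM2l ?invr_ge0//; exact: norm_mulmx_1Bexp.
Qed.

Lemma cesaro_cvg P f s : stochastic P ->
  (fun H : nat => H%:R^-1 * \sum_(i < H) (P ^+ i *m f) s 0) @ \oo -->
  (cesaro_limit P *m f) s 0.
Proof.
move=> Ps; rewrite mxE.
have -> : (fun H : nat => H%:R^-1 * \sum_(i < H) (P ^+ i *m f) s 0) =
    (fun H => \sum_u cesaro_mean P H s u * f u 0).
  apply/funext => H; rewrite mulr_sumr.
  under [RHS]eq_bigr do rewrite mxE summxE mulr_sumr mulr_suml.
  rewrite [RHS]exchange_big; apply: eq_bigr => i _; rewrite mxE mulr_sumr.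
  by apply: eq_bigr => u _; rewrite mulrA.
apply: cvg_finsum => u; apply: cvgMl.
apply: (@cvg_comp _ _ _ (cesaro_mean P) (fun M : 'M[R]_n => M s u)).
  exact: (proj1 (cesaro_mean_cvg_fixed Ps)).
exact: coord_continuous.
Qed.

Lemma cesaro_const P f s c : stochastic P ->
  (forall i, (P ^+ i *m f) s 0 = c) -> (cesaro_limit P *m f) s 0 = c.
Proof.
move=> Ps Pf; have /limit_unique lim_eq := @cesaro_cvg P f s Ps; apply: lim_eq.
rewrite -cvg_shiftS; under eq_fun do under eq_bigr do rewrite Pf.
rewrite [X in X @ _](_ : _ = fun=> c); first exact: cvg_cst.
by apply/funext => H /=; rewrite sumr_const card_ord -[c *+ _]mulr_natl mulrA
  mulVf ?mul1r ?pnatr_eq0.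
Qed.

Lemma cesaro_stochastic P : stochastic P -> stochastic (cesaro_limit P).
Proof.
move=> Ps; split=> [x y|x].
  have -> : cesaro_limit P x y = (cesaro_limit P *m delta_mx y (0 : 'I_1)) x 0.
    by rewrite -colE mxE.
  apply: cvgr_to_ge (@cesaro_cvg P _ x Ps) _; apply: nearW => H.
  rewrite mulr_ge0 ?invr_ge0// sumr_ge0// => i _.
  by rewrite -colE mxE; have [] := exp_stochastic i Ps.
have := @cesaro_const P (const_mx 1) x 1 Ps; rewrite mxE.
under eq_bigr do rewrite mxE mulr1; apply=> i.
rewrite mxE; under eq_bigr do rewrite mxE mulr1.
by have [] := exp_stochastic i Ps.
Qed.

Lemma col_mulmxP (A B : 'M[R]_n) :
  (forall f : 'cV[R]_n, A *m f = B *m f) -> A = B.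
Proof.
move=> AB; apply/matrixP => i j.
by have /matrixP/(_ i 0) := AB (delta_mx j 0); rewrite -!colE !mxE.
Qed.

Lemma cesaro_mulr P : stochastic P -> cesaro_limit P *m P = cesaro_limit P.
Proof. by move=> /cesaro_mean_cvg_fixed[]. Qed.

Lemma cesaro_mull P : stochastic P -> P *m cesaro_limit P = cesaro_limit P.
Proof.
move=> Ps; apply: col_mulmxP => f; apply/matrixP => s j; rewrite (ord1 j) {j}.
have lim_f := @cesaro_cvg P (P *m f) s Ps.
rewrite mulmxA cesaro_mulr// in lim_f.
apply: limit_unique lim_f; rewrite -mulmxA mxE.
have -> : (fun H : nat => H%:R^-1 * \sum_(i < H) (P ^+ i *m (P *m f)) s 0) =
    (fun H : nat => \sum_u P s u * (H%:R^-1 * \sum_(i < H) (P ^+ i *m f) u 0)).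
  apply/funext => H; under [RHS]eq_bigr do rewrite mulrCA mulr_sumr.
  rewrite -mulr_sumr [in RHS]exchange_big; congr (_ * _); apply: eq_bigr => i _.
  by rewrite mulmxA mulmxE -exprSr exprS -mulmxE -mulmxA mxE.
by apply: cvg_finsum => u; apply: cvgMr; exact: cesaro_cvg.
Qed.

Lemma exp_mulmx_fixed P f i : P *m f = f -> P ^+ i *m f = f.
Proof.
move=> Pf; elim: i => [|i IH]; first by rewrite expr0 mul1mx.
by rewrite exprSr -mulmxE -mulmxA Pf.
Qed.

Lemma cesaro_fixed P f : stochastic P -> P *m f = f -> cesaro_limit P *m f = f.
Proof.
move=> Ps Pf; apply/matrixP => s j; rewrite (ord1 j).
by apply: cesaro_const => // i; rewrite exp_mulmx_fixed.
Qed.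

Lemma cesaro_idem P : stochastic P ->
  cesaro_limit P *m cesaro_limit P = cesaro_limit P.
Proof.
move=> Ps; apply: col_mulmxP => f; rewrite -mulmxA cesaro_fixed//.
by rewrite mulmxA cesaro_mull.
Qed.

Lemma unitmx_inj (Z : 'M[R]_n) :
  (forall y : 'cV[R]_n, Z *m y = 0 -> y = 0) -> Z \in unitmx.
Proof.
move=> Zinj; rewrite -unitmx_tr -row_free_unit -kermx_eq0.
apply/eqP/row_matrixP => i; rewrite row0; apply: trmx_inj; rewrite trmx0.
by apply: Zinj; apply: trmx_inj; rewrite trmx_mul trmxK -row_mul mulmx_ker row0 trmx0.
Qed.

(** The fundamental matrix of Kemeny and Snell: a vector killed by 1 - P + P* is
    killed by P* (multiply by it), hence fixed by P, hence by P*. *)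
Lemma fundamental_unitmx P : stochastic P ->
  1%:M - P + cesaro_limit P \in unitmx.
Proof.
move=> Ps; set L := cesaro_limit P; apply: unitmx_inj => y Zy.
have Ly : L *m y = 0.
  have := congr1 (mulmx L) Zy; rewrite mulmx0 mulmxA mulmxDr mulmxBr mulmx1.
  by rewrite cesaro_mulr// subrr add0r cesaro_idem.
have Py : P *m y = y.
  move: Zy; rewrite mulmxDl Ly addr0 mulmxBl mul1mx => /eqP.
  by rewrite subr_eq0 => /eqP.
by rewrite -Ly /L cesaro_fixed.
Qed.

(** The differential value v = (1 - P + P* )^-1 (1 - P* ) r solves the Poisson
    equation, because P* v = 0. *)
Lemma poisson P (r : 'cV[R]_n) (L := cesaro_limit P)
    (v := invmx (1%:M - P + L) *m (1%:M - L) *m r) : stochastic P ->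
  v = r + P *m v - L *m r.
Proof.
move=> Ps; set Z := 1%:M - P + L.
have Zu : Z \in unitmx by exact: fundamental_unitmx.
have LZ : L *m Z = L.
  by rewrite /Z mulmxDr mulmxBr mulmx1 cesaro_mulr// subrr add0r cesaro_idem.
have Zv : Z *m v = r - L *m r by rewrite /v !mulmxA mulmxV// mul1mx mulmxBl mul1mx.
have Lv : L *m v = 0.
  by rewrite -LZ -mulmxA Zv mulmxBr mulmxA cesaro_idem// subrr.
move: Zv; rewrite /Z mulmxDl Lv addr0 mulmxBl mul1mx => /eqP.
by rewrite subr_eq addrAC => /eqP.
Qed.

End CesaroLimit.

(** * Recurrent classes and visits to transient states *)

Section Classes.
Context {R : realType} {n : nat}.
Variable P : 'M[R]_n.
Hypothesis stochP : stochastic P.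
Implicit Types (f y : 'cV[R]_n) (s t u x z : 'I_n).
Local Notation L := (cesaro_limit P).

Lemma nonstep0 x u : ~~ step P x u -> P x u = 0.
Proof. by rewrite /step -leNgt => le0; apply/eqP; rewrite eq_le le0 (proj1 stochP). Qed.

Lemma harmonic_class_const f s u : P *m f = f ->
  essential (step P) s -> connect (step P) s u -> f u 0 = f s 0.
Proof.
move=> Pf ess su.
have [x sx xmin] := Order.TotalTheory.arg_minP (fun z => f z 0) (connect0 (step P) s).
have cst z : connect (step P) x z -> f z 0 = f x 0.
  apply: (@minimum_principle _ _ P (fun z => f z 0) x) => // [w xw|w _ _].
    by apply: xmin; exact: connect_trans sx xw.
  by rewrite -[in leRHS]Pf mxE.
have xs := ess _ sx.
by rewrite (cst _ xs) (cst _ (connect_trans xs su)).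
Qed.

(** Started from an essential state, the chain never leaves its class. *)
Lemma exp_class_const f s i :
  (forall x u, essential (step P) x -> step P x u -> f u 0 = f x 0) ->
  essential (step P) s -> (P ^+ i *m f) s 0 = f s 0.
Proof.
move=> fE; elim: i s => [|i IH] s ess; first by rewrite expr0 mul1mx.
rewrite exprS -mulmxE -mulmxA mxE -[RHS]mul1r -(proj2 stochP s) mulr_suml.
apply: eq_bigr => u _; have [su|/nonstep0 ->] := boolP (step P s u); last by rewrite !mul0r.
by rewrite IH ?(fE _ _ ess su)//; exact: essential_connect ess (connect1 su).
Qed.

Lemma cesaro_class_const f s :
  (forall x u, essential (step P) x -> step P x u -> f u 0 = f x 0) ->
  essential (step P) s -> (L *m f) s 0 = f s 0.
Proof. by move=> fE ess; apply: cesaro_const => // i; exact: exp_class_const. Qed.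

Variable E : pred 'I_n.
Hypothesis EP : forall s, E s <-> essential (step P) s.

Lemma step_closed x u : E x -> step P x u -> E u.
Proof. by move=> /EP ess xu; apply/EP; exact: essential_connect ess (connect1 xu). Qed.

Definition killed : 'M[R]_n :=
  \matrix_(x, u) (if ~~ E x && ~~ E u then P x u else 0).

Lemma killed_mulmx f x : (killed *m f) x 0 =
  if E x then 0 else \sum_(u | ~~ E u) P x u * f u 0.
Proof.
rewrite mxE; case: ifP => Ex.
  by rewrite big1// => u _; rewrite mxE Ex mul0r.
rewrite [RHS]big_mkcond; apply: eq_bigr => u _; rewrite mxE Ex /=.
by case: ifP; rewrite ?mul0r.
Qed.

(** A negative minimum of y would be attained at a transient state and spread
    along every path that leaves it, up to the recurrent states, where y may be
    replaced by 0. *)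
Lemma killed_superharmonic_ge0 y :
  (forall x, 0 <= y x 0 - (killed *m y) x 0) -> forall x, 0 <= y x 0.
Proof.
move=> ysup x0.
have [x _ xmin] := Order.TotalTheory.arg_minP (fun z => y z 0) (isT : predT x0).
apply: le_trans (xmin x0 isT); rewrite leNgt; apply/negP => yx.
have yE z : E z -> 0 <= y z 0 by move=> Ez; have := ysup z; rewrite killed_mulmx Ez subr0.
have Ex : ~~ E x by apply: contraL yx => /yE; rewrite leNgt.
pose f z := if E z then 0 else y z 0.
have fx : f x = y x 0 by rewrite /f (negbTE Ex).
have [r xr essr] := exists_essential (step P) x.
have Er : E r by apply/EP.
suff : f r = f x by rewrite fx /f Er => y0; move: yx; rewrite -y0 ltxx.
apply: (@minimum_principle _ _ P f x) => // [z _|z _ fz].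
  by rewrite fx /f; case: ifP => _; [exact: ltW|exact: xmin].
have Ez : E z = false by apply/negP => Ez; move: fz yx; rewrite fx /f Ez => <-; rewrite ltxx.
have := ysup z; rewrite killed_mulmx Ez subr_ge0 /f Ez; apply: le_trans.
rewrite [leRHS]big_mkcond; apply: ler_sum => u _.
by case: ifP; rewrite ?mulr0.
Qed.

Lemma killed_unitmx : 1%:M - killed \in unitmx.
Proof.
apply: unitmx_inj => y; rewrite mulmxBl mul1mx => y0.
have y_ge0 := @killed_superharmonic_ge0 y.
have y_le0 := @killed_superharmonic_ge0 (- y).
apply/matrixP => x j; rewrite (ord1 j) mxE; apply/eqP; rewrite eq_le.
have eq0 z : y z 0 - (killed *m y) z 0 = 0 by have /matrixP/(_ z 0) := y0; rewrite !mxE.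
rewrite y_ge0 ?andbT => [|z]; last by rewrite eq0.
have := y_le0 _ x; rewrite mxE oppr_ge0; apply=> z.
by rewrite mulmxN mxE [X in _ - X]mxE -opprD eq0 oppr0.
Qed.

Lemma killed_inv_ge0 x z : 0 <= invmx (1%:M - killed) x z.
Proof.
suff : 0 <= col z (invmx (1%:M - killed)) x 0 by rewrite mxE.
apply: killed_superharmonic_ge0 => u.
have -> : (killed *m col z (invmx (1%:M - killed))) =
   col z (invmx (1%:M - killed)) - delta_mx z 0.
  rewrite colE mulmxA -{1}(subKr 1%:M killed) mulmxBl mul1mx mulmxV ?killed_unitmx//.
  by rewrite mulmxBl mul1mx.
by rewrite !mxE opprD addrA subrr add0r opprK; case: eqP => //= _; case: eqP.
Qed.

(** In stationary regime the transient mass is preserved by the killed chain, as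
    nothing enters it from the recurrent states; so it is 0. *)
Lemma cesaro_transient s t : ~~ E t -> L s t = 0.
Proof.
move=> Et.
pose v : 'rV[R]_n := \row_u (if E u then 0 else L s u).
have vK : v *m killed = v.
  apply/rowP => u; rewrite [RHS]mxE mxE.
  under eq_bigr do rewrite !mxE.
  case: ifP => Eu; first by rewrite big1// => x _; rewrite andbF mulr0.
  rewrite -[in RHS](cesaro_mulr stochP) mxE; apply: eq_bigr => x _.
  case: ifP => Ex /=; last by [].
  rewrite mul0r nonstep0 ?mulr0//; apply/negP => xu.
  by move: Eu; rewrite (step_closed Ex xu).
have v0 : v = 0.
  rewrite -[v]mulmx1 -(mulmxV killed_unitmx) mulmxA mulmxBr mulmx1 vK subrr.
  by rewrite mul0mx.
by have /rowP/(_ t) := v0; rewrite !mxE (negbTE Et).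
Qed.

Section Visits.
Variable mu : 'rV[R]_n.
Hypothesis mu_simplex : simplex mu.
Let delta : 'rV[R]_n := mu *m invmx (1%:M - killed).

Lemma killed_ge0 x u : 0 <= killed x u.
Proof. by rewrite mxE; case: ifP => // _; rewrite (proj1 stochP). Qed.

Lemma visitsE : delta = mu + delta *m killed.
Proof.
apply/eqP; rewrite -subr_eq -[X in X - _]mulmx1 -mulmxBr -mulmxA.
by rewrite mulVmx ?mulmx1// killed_unitmx.
Qed.

Lemma visits_sum u : delta 0 u = mu 0 u + \sum_x delta 0 x * killed x u.
Proof.
suff entry (v : 'rV[R]_n) : v = mu + v *m killed ->
    v 0 u = mu 0 u + \sum_x v 0 x * killed x u by exact: entry visitsE.
by move=> {1}->; rewrite mxE; congr (_ + _); rewrite mxE.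
Qed.

Lemma visits_ge0 s : 0 <= delta 0 s.
Proof.
rewrite mxE sumr_ge0// => u _.
by rewrite mulr_ge0 ?killed_inv_ge0//; have [] := mu_simplex.
Qed.

Lemma le_visits s : mu 0 s <= delta 0 s.
Proof.
rewrite visits_sum lerDl sumr_ge0// => u _.
by rewrite mulr_ge0 ?visits_ge0 ?killed_ge0.
Qed.

Lemma visits_mass : \sum_x delta 0 x * (1 - \sum_u killed x u) = 1.
Proof.
rewrite -[RHS](proj2 mu_simplex).
under eq_bigr do rewrite mulrBr mulr1 mulr_sumr.
rewrite sumrB [X in _ - X]exchange_big -sumrB; apply: eq_bigr => u _ /=.
by rewrite visits_sum addrK.
Qed.

(** The chain started from mu leaves the transient states only once, so each
    edge x -> y that leaves them satisfies delta x * P x y <= 1; going back along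
    a path, a state from which the exit is reachable cannot be visited too often.
    The bound depends on P only through c. *)
Lemma visits_bound c s : 0 <= c <= 1 ->
  (forall x u, step P x u -> c <= P x u) -> ~~ E s -> c ^+ n * delta 0 s <= 1.
Proof.
move=> c01 cP Es.
have killed_sum x : \sum_u killed x u <= 1.
  rewrite -(proj2 stochP x); apply: ler_sum => u _; rewrite mxE.
  by case: ifP => // _; rewrite (proj1 stochP).
pose w x := if E x then 1 else delta 0 x.
have [r sr essr] := exists_essential (step P) s.
have Er : E r by apply/EP.
suff : c ^+ n * w s <= w r by rewrite /w Er (negbTE Es).
have /andP[c0 c1] := c01.
apply: path_decay sr => // [u|x u xu]; first by rewrite /w; case: ifP; rewrite ?visits_ge0.
rewrite /w; case: ifP => Ex; first by rewrite (step_closed Ex xu) mulr1.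
case: ifP => Eu.
- apply: (@le_trans _ _ (delta 0 x * (1 - \sum_z killed x z))).
    rewrite mulrC ler_wpM2l ?visits_ge0// (le_trans (cP _ _ xu))// lerBrDr.
    rewrite -[leRHS](proj2 stochP x) [leRHS](bigD1 u)//= lerD2l (bigD1 u)//=.
    rewrite mxE Eu andbF add0r; apply: ler_sum => z _; rewrite mxE.
    by case: ifP => // _; rewrite (proj1 stochP).
  rewrite -[leRHS]visits_mass [leRHS](bigD1 x)//= lerDl sumr_ge0// => z _.
  by rewrite mulr_ge0 ?visits_ge0// subr_ge0.
- rewrite (visits_sum u) (bigD1 x)//= addrCA.
  rewrite (@le_trans _ _ (delta 0 x * killed x u))//.
    have -> : killed x u = P x u by rewrite mxE Ex Eu.
    by rewrite mulrC ler_wpM2l ?visits_ge0// cP.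
  rewrite lerDl addr_ge0//; first by have [] := mu_simplex.
  by apply: sumr_ge0 => z _; rewrite mulr_ge0 ?visits_ge0 ?killed_ge0.
Qed.

End Visits.

(** The stationary law started from an essential state lives on the class of that
    state, and along each edge it loses at most a factor c. *)
Lemma cesaro_diag_bound c s : 0 <= c <= 1 ->
  (forall x u, step P x u -> c <= P x u) -> E s -> c ^+ n <= n%:R * L s s.
Proof.
move=> c01 cP Es; have ess := proj1 (EP s) Es.
have [L0 _] := cesaro_stochastic stochP; have /andP[c0 c1] := c01.
have decay u : connect (step P) s u -> c ^+ n * L s u <= L s s.
  move=> /ess us; apply: path_decay us => // x y xy.
  rewrite -[in leRHS](cesaro_mulr stochP) mxE (bigD1 x)//= mulrC.
  rewrite (@le_trans _ _ (L s x * P x y))//; first by rewrite ler_wpM2l ?cP.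
  by rewrite lerDl sumr_ge0// => z _; rewrite mulr_ge0// (proj1 stochP).
pose f : 'cV[R]_n := \col_u (connect (step P) s u)%:R.
have mass : \sum_u L s u * f u 0 = 1.
  have := @cesaro_class_const f s; rewrite mxE => -> //; first by rewrite mxE connect0.
  move=> x u essx xu; rewrite !mxE; congr (_%:R); congr nat_of_bool.
  apply/idP/idP => [su|sx]; last exact: connect_trans sx (connect1 xu).
  exact: connect_trans su (essx _ (connect1 xu)).
rewrite -[leLHS]mulr1 -[X in _ * X <= _]mass mulr_sumr.
apply: (@le_trans _ _ (\sum_(u < n) L s s)); last by rewrite sumr_const card_ord mulr_natl.
apply: ler_sum => u _; rewrite mxE; case: (boolP (connect _ s u)) => su.
  by rewrite mulr1 decay.
by rewrite !mulr0.
Qed.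

End Classes.

(** * The average reward and the performance difference identity *)

Lemma sum_tuple_cons (R : realType) (T : finType) (k : nat) (F : seq T -> R) :
  \sum_(t : k.+1.-tuple T) F t = \sum_x \sum_(t : k.-tuple T) F (x :: t).
Proof.
rewrite pair_bigA /= (reindex (fun p : T * k.-tuple T => [tuple of p.1 :: p.2])) //=.
exists (fun t : k.+1.-tuple T => (thead t, [tuple of behead t])).
  by move=> [x t] _ /=; congr (_, _); apply: val_inj.
by move=> t _; rewrite /= [RHS]tuple_eta; apply: val_inj.
Qed.

Lemma sum_pair (R : realType) (S T : finType) (F : S * T -> R) :
  \sum_p F p = \sum_s \sum_t F (s, t).
Proof. by rewrite pair_bigA; apply: eq_bigr => -[]. Qed.

Lemma sum_tuple0 (R : realType) (T : finType) (F : seq T -> R) :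
  \sum_(t : 0.-tuple T) F t = F [::].
Proof. by rewrite (big_pred1 [tuple])// => t; apply/esym/eqP; exact: tuple0. Qed.

Section MDP.
Context {R : realType} {n m : nat}.
Variable M : mdp R n m.
Implicit Types (pi : @policy R n m) (mu nu : 'rV[R]_n) (s : 'I_n) (a : 'I_m).

Lemma kernel_pi_stochastic pi : policies pi -> stochastic (kernel_pi M pi).
Proof.
move=> ppi; split=> [x y|x].
  rewrite mxE sumr_ge0// => a _; have [pi_ge0 _] := ppi x.
  by have [k_ge0 _] := kernel_simplex M x a; rewrite mulr_ge0.
under eq_bigr do rewrite mxE; rewrite exchange_big /=.
have [_ pi1] := ppi x; rewrite -[RHS]pi1; apply: eq_bigr => a _.
by have [_ k1] := kernel_simplex M x a; rewrite -mulr_sumr k1 mulr1.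
Qed.

Lemma traj_mass pi nu H : policies pi -> simplex nu ->
  \sum_(tau : H.-tuple ('I_n * 'I_m)) traj_prob M pi nu tau = 1.
Proof.
move=> ppi; elim: H nu => [|H IH] nu [nu0 nu1].
  by rewrite sum_tuple0.
rewrite sum_tuple_cons -nu1 sum_pair /=.
apply: eq_bigr => s _; under eq_bigr do rewrite -mulr_sumr (IH _ (kernel_simplex _ _ _)) mulr1.
by rewrite -mulr_sumr (proj2 (ppi s)) mulr1.
Qed.

(** Conditioning on the first transition: the return over H + 1 steps from s
    averages to r s + (P w) s, where w is the expected return over H steps. *)
Lemma traj_return pi nu H : policies pi -> simplex nu ->
  \sum_(tau : H.-tuple ('I_n * 'I_m))
     traj_prob M pi nu tau * \sum_(x <- tau) reward M x.1 x.2 =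
  \sum_s nu 0 s * \sum_(i < H) (kernel_pi M pi ^+ i *m reward_pi M pi) s 0.
Proof.
move=> ppi; elim: H nu => [|H IH] nu nuP.
  rewrite (sum_tuple0 (fun tau => traj_prob M pi nu tau * \sum_(x <- tau) reward M x.1 x.2)).
  by rewrite big_nil mulr0 big1// => s _; rewrite big_ord0 mulr0.
pose w s := \sum_(i < H) (kernel_pi M pi ^+ i *m reward_pi M pi) s 0.
rewrite (sum_tuple_cons _ (fun tau => traj_prob M pi nu tau * \sum_(x <- tau) reward M x.1 x.2)).
rewrite sum_pair /=.
apply: eq_bigr => s _.
have step_return a : \sum_(t : H.-tuple ('I_n * 'I_m)) nu 0 s * pi s 0 a *
    traj_prob M pi (Defs.kernel M s a) t * (\sum_(x <- (s, a) :: t) reward M x.1 x.2) =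
    nu 0 s * (pi s 0 a * reward M s a + pi s 0 a * \sum_u Defs.kernel M s a 0 u * w u).
  rewrite -mulrDr mulrA -(IH _ (kernel_simplex M s a)).
  have mass := traj_mass H ppi (kernel_simplex M s a).
  rewrite -[X in X + _]mulr1 -mass mulr_sumr -big_split mulr_sumr /=.
  apply: eq_bigr => t _; rewrite big_cons /= !mulrDr -!mulrA.
  by congr (_ + _); rewrite (mulrC (reward M s a)).
under eq_bigr do rewrite step_return.
rewrite -mulr_sumr big_split /=; congr (_ * _).
rewrite big_ord_recl expr0 mul1mx /= mxE; congr (_ + _).
under [RHS]eq_bigr do rewrite /bump /= add1n exprS -mulmxE -mulmxA mxE.
rewrite exchange_big /=.
under eq_bigr do rewrite mulr_sumr.
rewrite exchange_big /=; apply: eq_bigr => u _.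
rewrite -mulr_sumr mxE mulr_suml; apply: eq_bigr => a _.
by rewrite mulrA.
Qed.

Lemma JvalE pi s : policies pi -> Jval M pi s = (Pstar M pi *m reward_pi M pi) s 0.
Proof.
move=> ppi; rewrite /Jval.
have -> : (fun H : nat => H%:R^-1 * expected_return M pi H s) = (fun H : nat =>
    H%:R^-1 * \sum_(i < H) (kernel_pi M pi ^+ i *m reward_pi M pi) s 0).
  apply/funext => H; congr (_ * _); rewrite /expected_return traj_return//.
    rewrite (bigD1 s)//= mxE !eqxx mul1r [X in _ + X]big1 ?addr0// => u us.
    by rewrite mxE eqxx (negbTE us) mul0r.
  split=> [u|]; first by rewrite mxE; case: andP.
  rewrite (bigD1 s)//= mxE !eqxx big1 ?addr0// => u us.
  by rewrite mxE eqxx (negbTE us).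
by have [] := cvg_limn_inf_sup (@cesaro_cvg _ _ _ (reward_pi M pi) s (kernel_pi_stochastic ppi)).
Qed.

(** The graph of all transitions that some action makes possible; it is the
    transition graph of every policy with full support. *)
Definition edge : rel 'I_n := fun x y => [exists a, 0 < Defs.kernel M x a 0 y].

Lemma step_kernel_pi pi : policies_pos pi -> step (kernel_pi M pi) =2 edge.
Proof.
move=> pos x y; have [[pi0 _] pi_gt0] := pos x.
have k0 a : 0 <= Defs.kernel M x a 0 y by have [] := kernel_simplex M x a.
have term_ge0 a : 0 <= pi x 0 a * Defs.kernel M x a 0 y by rewrite mulr_ge0.
rewrite /step mxE; apply/idP/existsP => [|[a ka]].
  rewrite lt_def sumr_ge0// andbT => /eqP nz; apply: contrapT => nex.
  apply: nz; apply: big1 => a _; apply/eqP; rewrite mulf_eq0 eq_sym; apply/orP; right.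
  rewrite eq_le k0 andbT leNgt; apply/negP => ka; apply: nex; by exists a.
by rewrite (bigD1 a)//= ltr_pwDl ?mulr_gt0// sumr_ge0.
Qed.

Lemma policies_posW pi : policies_pos pi -> policies pi.
Proof. by move=> pos s; have [] := pos s. Qed.

Lemma recurrent_state_essential pi s : policies_pos pi ->
  recurrent_state M s <-> essential (step (kernel_pi M pi)) s.
Proof.
move=> pos; have edgeE := eq_essential s (step_kernel_pi pos).
split=> [/asboolP/(_ pi pos) rec|ess].
  by apply/recurrentP => //; exact: kernel_pi_stochastic (policies_posW pos).
apply/asboolP => pi' pos'.
apply/recurrentP; first exact: kernel_pi_stochastic (policies_posW pos').
by apply/(eq_essential s (step_kernel_pi pos'))/edgeE.
Qed.

(** The performance difference identity. Write J, J' for the average rewards of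
    pi, pi' and P', L' for the kernel of pi' and its Cesaro limit. On recurrent
    states the Poisson equation turns the advantage of pi' under Q into
    J' - L' J after averaging by L'; on transient states the advantage under K is
    P' J - J, and summing it over the visits gives L' J - J, because L' J = J on
    the recurrent classes. The two parts add up to J' - J. *)
Lemma performance_difference mu pi pi' : policies_pos pi -> policies_pos pi' ->
  Jmu M mu pi' - Jmu M mu pi =
  \sum_s rho M mu pi' s * \sum_a Gval M pi s a * (pi' s 0 a - pi s 0 a).
Proof.
move=> pos pos'.
set P := kernel_pi M pi; set P' := kernel_pi M pi'.
set r := reward_pi M pi; set r' := reward_pi M pi'.
set L := Pstar M pi; set L' := Pstar M pi'.
set J := L *m r; set J' := L' *m r'; set V := Vval M pi.
set E := recurrent_state M.
have Ps : stochastic P := kernel_pi_stochastic (policies_posW pos).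
have Ps' : stochastic P' := kernel_pi_stochastic (policies_posW pos').
have EP s : E s <-> essential (step P) s := recurrent_state_essential s pos.
have EP' s : E s <-> essential (step P') s := recurrent_state_essential s pos'.
have JE s : Jval M pi s = J s 0 := JvalE s (policies_posW pos).
have JE' s : Jval M pi' s = J' s 0 := JvalE s (policies_posW pos').
have PJ : P *m J = J by rewrite mulmxA cesaro_mull.
have VE : V = r + P *m V - J := poisson r Ps.
have addcE (f f' : 'cV[R]_n) s : (f + f') s 0 = f s 0 + f' s 0 by rewrite mxE.
have subcE (f f' : 'cV[R]_n) s : (f - f') s 0 = f s 0 - f' s 0 by rewrite !mxE.
have kernelE (f : 'cV[R]_n) (q : policy) s :
    \sum_a (\sum_u Defs.kernel M s a 0 u * f u 0) * q s 0 a = (kernel_pi M q *m f) s 0.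
  rewrite mxE; under eq_bigr do rewrite mulr_suml.
  rewrite exchange_big; apply: eq_bigr => u _; rewrite mxE mulr_suml.
  by apply: eq_bigr => a _; rewrite mulrAC [_ * q _ _ _]mulrC.
have KE (q : policy) s : \sum_a Kval M pi s a * q s 0 a = (kernel_pi M q *m J) s 0.
  rewrite -kernelE; apply: eq_bigr => a _; congr (_ * _); rewrite /Kval.
  by apply: eq_bigr => u _; rewrite JE.
have QE (q : policy) s : \sum_a Qval M pi s a * q s 0 a =
    (reward_pi M q + kernel_pi M q *m V - kernel_pi M q *m J) s 0.
  rewrite /Qval; under eq_bigr do rewrite mulrBl mulrDl.
  rewrite sumrB big_split /= KE kernelE subcE addcE; congr (_ + _ - _).
  by rewrite mxE; apply: eq_bigr => a _; rewrite mulrC.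
pose q := r' + P' *m V - P' *m J - V.
pose g := P' *m J - J.
have qE s : \sum_a Qval M pi s a * (pi' s 0 a - pi s 0 a) = q s 0.
  under eq_bigr do rewrite mulrBr.
  by rewrite sumrB !QE PJ -VE /q subcE.
have gE s : \sum_a Kval M pi s a * (pi' s 0 a - pi s 0 a) = g s 0.
  under eq_bigr do rewrite mulrBr.
  by rewrite sumrB !KE PJ /g subcE.
have Lq : L' *m q = J' - L' *m J.
  rewrite /q !mulmxBr mulmxDr !mulmxA cesaro_mulr//.
  by rewrite -/J' addrAC addrK.
pose gT : 'cV[R]_n := \col_s (g s 0 * (~~ E s)%:R).
have J_edge x u : essential (step P') x -> step P' x u -> J u 0 = J x 0.
  move=> /EP' /EP ess; rewrite step_kernel_pi// -(step_kernel_pi pos) => xu.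
  exact: harmonic_class_const PJ ess (connect1 xu).
have yE x : E x -> (L' *m J - J) x 0 = 0.
  move=> /EP' ess; have fixJ := cesaro_class_const Ps' J_edge ess.
  by rewrite subcE fixJ subrr.
have NgT : invmx (1%:M - killed P' E) *m gT = L' *m J - J.
  apply: (canLR (mulKmx (killed_unitmx Ps' EP'))).
  apply/colP => x; rewrite mulmxBl mul1mx.
  rewrite [RHS]subcE killed_mulmx mxE.
  case: ifPn => Ex; first by rewrite mulr0 yE// subrr.
  have -> : \sum_(u | ~~ E u) P' x u * (L' *m J - J) u 0 = (P' *m (L' *m J - J)) x 0.
    rewrite mxE [LHS]big_mkcond; apply: eq_bigr => u _.
    by case: ifPn => // /negPn /yE ->; rewrite mulr0.
  have -> : P' *m (L' *m J - J) = (L' *m J - J) - g.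
    by rewrite mulmxBr [P' *m (L' *m J)]mulmxA cesaro_mull// /g opprB addrA subrK.
  by rewrite mulr1 [X in _ - X]subcE subKr.
have -> : Jmu M mu pi' - Jmu M mu pi = (mu *m (J' - J)) 0 0.
  rewrite /Jmu -sumrB [RHS]mxE; apply: eq_bigr => s _.
  by rewrite JE JE' subcE mulrBr.
have -> : J' - J = L' *m q + invmx (1%:M - killed P' E) *m gT.
  by rewrite Lq NgT addrA subrK.
rewrite mulmxDr !mulmxA mxE [X in X + _]mxE [X in _ + X]mxE -big_split /=.
apply: eq_bigr => s _.
have -> : (mu *m L') 0 s = dvisit M mu pi' s by rewrite mxE.
have -> : (mu *m invmx (1%:M - killed P' E)) 0 s = tvisit M mu pi' s by rewrite mxE.
rewrite /rho /transient_state -/E [gT s 0]mxE.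
have [Es|Es] /= := boolP (E s).
  rewrite !mulr0 !addr0 mulr1 -qE; congr (_ * _); apply: eq_bigr => a _.
  by rewrite /Gval /transient_state -/E Es mulr1 mulr0 addr0.
have -> : dvisit M mu pi' s = 0.
  rewrite /dvisit big1// => u _.
  by rewrite [Pstar _ _ _ _](cesaro_transient Ps' EP' u Es) mulr0.
rewrite !mul0r !add0r !mulr1 -gE; congr (_ * _); apply: eq_bigr => a _.
by rewrite /Gval /transient_state -/E (negbTE Es) mulr1 mulr0 add0r.
Qed.

(** * Uniform bounds on the visitation measure *)

Lemma policies_ge_pos alpha pi : 0 < alpha -> policies_ge alpha pi -> policies_pos pi.
Proof.
move=> alpha_gt0 ge s; have [ps pa] := ge s.
by split=> // a; exact: lt_le_trans (pa a).
Qed.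

Lemma finite_pos_lower_bound (T : finType) (f : T -> R) :
  exists k, [/\ 0 < k, k <= 1 & forall t, 0 < f t -> k <= f t].
Proof.
exists (\big[Num.min/1]_(t | 0 < f t) f t); split.
- by apply: lt_bigmin => //; exact: ltr01.
- exact: bigmin_le_id.
- by move=> t ft; exact: bigmin_le_cond.
Qed.

(** The constant is alpha times the smallest positive entry of the kernel, so it
    does not depend on the policy. *)
Lemma step_lower_bound alpha : 0 < alpha <= 1 -> exists c, 0 < c <= 1 /\
  forall pi, policies_ge alpha pi -> forall x y,
    step (kernel_pi M pi) x y -> c <= kernel_pi M pi x y.
Proof.
move=> /andP[alpha_gt0 alpha_le1].
have [k [k_gt0 k_le1 kP]] := finite_pos_lower_bound
  (fun t : 'I_n * 'I_m * 'I_n => Defs.kernel M t.1.1 t.1.2 0 t.2).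
exists (alpha * k); split=> [|pi ge x y].
  by rewrite mulr_gt0//= mulr_ile1// ltW.
rewrite (step_kernel_pi (policies_ge_pos alpha_gt0 ge)) => /existsP[a ka].
have [[pi_ge0 _] pi_ge] := ge x.
rewrite mxE (bigD1 a)//= (@le_trans _ _ (pi x 0 a * Defs.kernel M x a 0 y))//.
  by rewrite ler_pM ?(ltW alpha_gt0) ?(ltW k_gt0)//; exact: (kP (x, a, y)).
rewrite lerDl sumr_ge0// => b _; rewrite mulr_ge0//.
by have [] := kernel_simplex M x b.
Qed.

(** On recurrent states rho pi s lies between mu s * Pstar pi s s and 1; on
    transient states it is an expected number of visits, at least mu s. Both
    remaining bounds, [cesaro_diag_bound] and [visits_bound], only involve the
    uniform lower bound on the transitions. *)
Lemma rho_bounds mu alpha : 0 < alpha <= 1 -> simplex_pos mu ->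
  exists b B, 0 < b /\ forall pi s, policies_ge alpha pi -> b <= rho M mu pi s <= B.
Proof.
move=> alpha01 [mu_simplex mu_gt0].
have [c [/andP[c0 c1] cP]] := step_lower_bound alpha01.
have [u [u_gt0 u_le1 uP]] := finite_pos_lower_bound (fun s => mu 0 s).
have c01 : 0 <= c <= 1 by rewrite ltW.
(* The denominator n.+1 rather than n is nonzero without a case analysis. *)
exists (u * (c ^+ n / n.+1%:R)), (c ^- n); split=> [|pi s ge].
  by rewrite !mulr_gt0 ?exprn_gt0 ?invr_gt0.
have /andP[alpha_gt0 _] := alpha01.
have pos := policies_ge_pos alpha_gt0 ge.
have Ps := kernel_pi_stochastic (policies_posW pos).
have EP t := recurrent_state_essential t pos.
have [L0 L1] := cesaro_stochastic Ps.
have le_cn : c ^+ n <= 1 by rewrite exprn_ile1// ltW.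
have le_frac : c ^+ n / n.+1%:R <= 1.
  by rewrite ler_pdivrMr// mul1r (le_trans le_cn)// ler1n.
rewrite /rho /transient_state; have [Es|Es] /= := boolP (recurrent_state M s).
- rewrite mulr0 addr0 mulr1 /dvisit; apply/andP; split.
    rewrite (bigD1 s)//= (@le_trans _ _ (mu 0 s * Pstar M pi s s))//; last first.
      rewrite lerDl sumr_ge0// => t _; apply: mulr_ge0; last exact: L0.
      by have [] := mu_simplex.
    rewrite ler_pM ?(ltW u_gt0) ?uP ?mulr_ge0 ?invr_ge0 ?exprn_ge0 ?(ltW c0)//.
    have bound := cesaro_diag_bound Ps EP c01 (cP pi ge) Es.
    rewrite ler_pdivrMr// mulrC (le_trans bound)// ler_wpM2r ?ler_nat//.
  apply: (@le_trans _ _ 1); last by rewrite invf_ge1 ?exprn_gt0// le_cn.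
  rewrite -(proj2 mu_simplex); apply: ler_sum => t _.
  rewrite ler_piMr//; first by have [] := mu_simplex.
  exact: le1_stochastic (cesaro_stochastic Ps).
- have -> : tvisit M mu pi s =
      (mu *m invmx (1%:M - killed (kernel_pi M pi) (recurrent_state M))) 0 s by rewrite mxE.
  rewrite mulr0 add0r mulr1; apply/andP; split.
    apply: le_trans (le_visits Ps EP mu_simplex s).
    by rewrite (le_trans _ (uP s _))// ler_piMr// ltW.
  rewrite -[leRHS]mul1r ler_pdivlMr ?exprn_gt0// mulrC.
  by have := visits_bound Ps EP mu_simplex c01 (cP pi ge) Es.
Qed.

Lemma rho_ratio_le_Calpha mu alpha pi pi' s : 0 < alpha <= 1 -> simplex_pos mu ->
  policies_ge alpha pi -> policies_ge alpha pi' ->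
  rho M mu pi s <= Calpha M mu alpha * rho M mu pi' s.
Proof.
move=> alpha01 mu_pos ge ge'.
have [b [B [b_gt0 bB]]] := rho_bounds alpha01 mu_pos.
have rho_gt0 p t : policies_ge alpha p -> 0 < rho M mu p t.
  by move=> /bB => /(_ t)/andP[le_b _]; exact: lt_le_trans le_b.
rewrite -ler_pdivrMr ?rho_gt0//; apply: ub_le_sup; last by exists s, pi, pi'.
exists (B / b) => _ [t [p [p' [gep gep' ->]]]].
have /andP[_ leB] := bB p t gep; have /andP[leb _] := bB p' t gep'.
apply: ler_pM => //; first exact: ltW (rho_gt0 _ _ gep).
  by rewrite invr_ge0 ltW// rho_gt0.
by rewrite lef_pV2 ?posrE ?rho_gt0.
Qed.

Lemma rho_ge0 mu alpha pi s : 0 < alpha <= 1 -> simplex_pos mu ->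
  policies_ge alpha pi -> 0 <= rho M mu pi s.
Proof.
move=> alpha01 mu_pos ge; have [b [B [b_gt0 bB]]] := rho_bounds alpha01 mu_pos.
by have /andP[le_b _] := bB pi s ge; apply: le_trans le_b; exact: ltW.
Qed.

Lemma Calpha_ge0 mu alpha pi : 0 < alpha <= 1 -> simplex_pos mu ->
  policies_ge alpha pi -> 0 <= Calpha M mu alpha.
Proof.
move=> alpha01 mu_pos ge; have [b [B [b_gt0 bB]]] := rho_bounds alpha01 mu_pos.
have [s _] : exists s, mu 0 s != 0.
  apply: contrapT => mu0; have [[_ mu1] _] := mu_pos.
  have := mu1; rewrite big1 => [/eqP|s _]; first by rewrite eq_sym oner_eq0.
  by apply: contrapT => /eqP mus; apply: mu0; exists s.
have /andP[le_b _] := bB pi s ge; have rho_gt0 := lt_le_trans b_gt0 le_b.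
rewrite -(pmulr_lge0 _ rho_gt0) (le_trans (ltW rho_gt0))//.
exact: (rho_ratio_le_Calpha s alpha01 mu_pos ge ge).
Qed.

End MDP.

(** * Bregman divergences and the proximal step *)

Section Proximal.
Context {R : realType} {m : nat}.
Implicit Types (p q x y g : 'rV[R]_m) (h : 'rV[R]_m -> R) (alpha : R).

Lemma dotBr g p q : dot g (p - q) = dot g p - dot g q.
Proof. by rewrite /dot -sumrB; apply: eq_bigr => i _; rewrite !mxE mulrBr. Qed.

Lemma dotDr g p q : dot g (p + q) = dot g p + dot g q.
Proof. by rewrite /dot -big_split; apply: eq_bigr => i _; rewrite !mxE mulrDr. Qed.

Lemma dotBl g g' p : dot (g - g') p = dot g p - dot g' p.
Proof. by rewrite /dot -sumrB; apply: eq_bigr => i _; rewrite !mxE mulrBl. Qed.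

Lemma dotZr g t p : dot g (t *: p) = t * dot g p.
Proof. by rewrite /dot mulr_sumr; apply: eq_bigr => i _; rewrite mxE mulrCA. Qed.

Lemma simplex_ge_relint alpha p : 0 < alpha -> simplex_ge alpha p -> simplex_relint p.
Proof.
move=> alpha0 [ps pa]; split=> //.
have pos_near : nbhs p (fun q : 'rV[R]_m => forall i, 0 < q 0 i).
  apply: (@filter_forall _ _ (fun i (q : 'rV[R]_m) => 0 < q 0 i) _ (nbhs_filter p)) => i.
  have p_gt0 : 0 < p 0 i := lt_le_trans alpha0 (pa i).
  exact: (cvgr_gt (p 0 i) (@coord_continuous R 1 m 0 i p) 0 p_gt0).
apply: filterS pos_near => q q0 q1; split=> // i; exact: ltW.
Qed.

Lemma simplex_ge_segment alpha p q t : 0 <= t <= 1 ->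
  simplex_ge alpha p -> simplex_ge alpha q -> simplex_ge alpha (t *: p + (1 - t) *: q).
Proof.
move=> /andP[t0 t1] [[p0 p1] pa] [[q0 q1] qa]; have t1' : 0 <= 1 - t by rewrite subr_ge0.
split; first split.
- by move=> i; rewrite !mxE addr_ge0 ?mulr_ge0.
- by under eq_bigr do rewrite !mxE; rewrite big_split /= -!mulr_sumr p1 q1 !mulr1 addrC subrK.
- move=> i; rewrite !mxE (@le_trans _ _ (t * alpha + (1 - t) * alpha))//.
    by rewrite -mulrDl addrC subrK mul1r.
  by rewrite lerD ?ler_wpM2l.
Qed.

Lemma simplex_ge0 p : simplex p -> simplex_ge 0 p.
Proof. by move=> ps; split=> //; case: ps. Qed.

Lemma simplex_segment p q t : 0 <= t <= 1 ->
  simplex p -> simplex q -> simplex (t *: p + (1 - t) *: q).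
Proof. by move=> t01 /simplex_ge0 ps /simplex_ge0 qs; have [] := simplex_ge_segment t01 ps qs. Qed.

(** The gradient along segments of the simplex, in the form in which it yields
    inequalities between directional derivatives. *)
Lemma gradient_segment h g p q e : gradient_at h q g -> simplex p -> simplex q ->
  0 < e -> exists t, 0 < t < 1 /\
    `|h (t *: p + (1 - t) *: q) - h q - t * dot g (p - q)| <= t * e.
Proof.
move=> grad ps qs e0.
(* The + 1 keeps N positive when p = q. *)
set N := `|p - q| + 1; have N0 : 0 < N by rewrite ltr_wpDl.
have /nbhs_normP[d /= d0 dP] := grad (e / N) (divr_gt0 e0 N0).
have [t [t0 t1 td]] : exists t, [/\ 0 < t, t < 1 & t * N < d].
  exists (Num.min (2^-1) (d / (2 * N))); split.
  - by rewrite lt_min invr_gt0 ltr0n divr_gt0// mulr_gt0.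
  - by rewrite gt_min invf_lt1 ?ltr1n.
  - apply: (@le_lt_trans _ _ (d / (2 * N) * N)).
      by apply: ler_wpM2r; [exact: ltW|rewrite ge_min lexx orbT].
    rewrite invfM mulrA mulfVK ?gt_eqF// ltr_pdivrMr// ltr_pMr// ltr1n//.
exists t; split; first by rewrite t0.
set z := t *: p + (1 - t) *: q.
have zq : z - q = t *: (p - q).
  by apply/rowP => i; rewrite !mxE; ring.
have norm_zq : `|z - q| = t * `|p - q| by rewrite zq normrZ gtr0_norm.
have bd : `|p - q| <= N by rewrite lerDl.
have := dP z; rewrite /= distrC norm_zq zq dotZr; move=> H.
apply: le_trans (H _ _) _.
- by rewrite (le_lt_trans _ td)// ler_wpM2l// ltW.
- by apply: simplex_segment => //; rewrite !ltW.
- rewrite mulrCA ler_wpM2l ?(ltW t0)// -mulrA ler_piMr ?(ltW e0)//.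
  by rewrite mulrC ler_pdivrMr// mul1r.
Qed.

Lemma le0_of_small (a : R) : (forall e, 0 < e -> a <= e) -> a <= 0.
Proof. by move=> small; apply/ler_addgt0Pr => e e0; rewrite add0r small. Qed.

Lemma bregman_ge0 h gradh p q : strictly_convex_on simplex_relint h ->
  C1_relint h gradh -> simplex_relint p -> simplex_relint q ->
  0 <= bregman h gradh p q.
Proof.
move=> cvx [grad _] pr qr; have [->|pq] := eqVneq p q.
  by rewrite /bregman dotBr !subrr.
rewrite -oppr_le0; apply: le0_of_small => e e0.
have [t [/andP[t0 t1]]] := gradient_segment (grad q qr) (proj1 pr) (proj1 qr) e0.
have t01 : 0 < t < 1 by rewrite t0.
have := cvx p q t pr qr pq t01; set z := t *: p + (1 - t) *: q => convex.
rewrite ler_norml => /andP[lower _].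
rewrite -(ler_pM2l t0) /bregman; nra.
Qed.

(** Optimality of x for the proximal problem centred at y, tested along the
    segment from x to p. *)
Lemma proximal_optimality h gradh alpha eta g x y p : 0 < alpha ->
  C1_relint h gradh ->
  argmax (simplex_ge alpha) (fun p => eta * dot g p - bregman h gradh p y) x ->
  simplex_ge alpha p ->
  eta * dot g (p - x) <= dot (gradh x - gradh y) (p - x).
Proof.
move=> alpha0 [grad _] [xA xmax] pA.
rewrite -subr_le0; apply: le0_of_small => e e0.
have xr := simplex_ge_relint alpha0 xA.
have [t [/andP[t0 t1]]] := gradient_segment (grad x xr) (proj1 pA) (proj1 xA) e0.
have t01 : 0 <= t <= 1 by rewrite !ltW.
have := xmax _ (simplex_ge_segment t01 pA xA); set z := t *: p + (1 - t) *: x => zx.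
have dot_z g' : dot g' z = t * dot g' p + (1 - t) * dot g' x by rewrite dotDr !dotZr.
rewrite ler_norml => /andP[_ upper].
rewrite -(ler_pM2l t0); move: zx upper; rewrite /bregman !dotBr !dot_z !dotBl.
nra.
Qed.

(** The right-hand side is identically the scalar product of gradh x - gradh y
    with p - x, which bounds the left-hand side by optimality of x. *)
Lemma proximal_three_point h gradh alpha eta g x y p : 0 < alpha ->
  C1_relint h gradh ->
  argmax (simplex_ge alpha) (fun p => eta * dot g p - bregman h gradh p y) x ->
  simplex_ge alpha p ->
  eta * dot g (p - x) <=
  bregman h gradh p y - bregman h gradh p x - bregman h gradh x y.
Proof.
move=> alpha0 C1 xmax pA.
apply: le_trans (proximal_optimality alpha0 C1 xmax pA) _.
by rewrite le_eqVlt; apply/orP; left; apply/eqP; rewrite /bregman dotBl !dotBr; ring.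
Qed.

Lemma compact_simplex_ge alpha : compact (simplex_ge alpha : set 'rV[R]_m).
Proof.
apply: bounded_closed_compact.
  exists 1; split=> // b b1 p [[p0 p1] _] /=.
  apply: le_trans (ltW b1); rewrite /Num.norm/= mx_normrE; apply: bigmax_le => // ij _.
  rewrite (ord1 ij.1) ger0_norm ?p0// -p1 (bigD1 ij.2)//= lerDl.
  by apply: sumr_ge0 => i _.
have coord_ge a : closed [set p : 'rV[R]_m | forall i, a <= p 0 i].
  rewrite (_ : [set _ | _] =
    \bigcap_(i in setT) ((fun p : 'rV[R]_m => p 0 i) @^-1` [set x | a <= x])).
    apply: closed_bigI => i _; apply: preimage_closed; last exact: closed_ge.
    by move=> p _; exact: coord_continuous.
  by apply/seteqP; split=> [p pa i _|p pa i]; [exact: pa|exact: (pa i)].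
rewrite (_ : simplex_ge alpha = [set p : 'rV[R]_m | forall i, 0 <= p 0 i] `&`
    ((fun p : 'rV[R]_m => \sum_i p 0 i) @^-1` [set x | x = 1]) `&`
    [set p : 'rV[R]_m | forall i, alpha <= p 0 i]); last first.
  by apply/seteqP; split=> [p [[p0 p1] pa]|p [[p0 p1] pa]].
apply: closedI; [apply: closedI|]; try exact: coord_ge.
apply: preimage_closed; last exact: closed_eq.
move=> p _; apply: (@cvg_finsum R _ (nbhs p) (nbhs_filter p)) => i.
exact: coord_continuous.
Qed.

Lemma cvg_dot g x (U : set_system 'rV[R]_m) (FU : Filter U) :
  U --> x -> dot g q @[q --> U] --> dot g x.
Proof.
move=> Ux; apply: cvg_finsum => i; apply: cvgMr.
exact: (cvg_comp _ _ Ux (@coord_continuous R 1 m 0 i x)).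
Qed.

Lemma gradient_cvg h g alpha x : gradient_at h x g ->
  h q @[q --> within (simplex_ge alpha) (nbhs x)] --> h x.
Proof.
move=> grad; apply/cvgrPdist_le => e e0.
have e2 : 0 < e / 2 by rewrite divr_gt0.
have lin : \forall q \near within (simplex_ge alpha) (nbhs x), `|dot g x - dot g q| <= e / 2.
  have : dot g q @[q --> within (simplex_ge alpha) (nbhs x)] --> dot g x.
    by apply: cvg_dot; exact: cvg_within.
  by move/cvgrPdist_le; apply.
have close : \forall q \near within (simplex_ge alpha) (nbhs x), `|x - q| <= e / 2.
  have : (id : 'rV[R]_m -> 'rV[R]_m) @ within (simplex_ge alpha) (nbhs x) --> x.
    exact: cvg_within.
  by move/cvgrPdist_le; apply.
have rem : \forall q \near within (simplex_ge alpha) (nbhs x),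
    `|h q - h x - dot g (q - x)| <= `|q - x|.
  have := grad 1 ltr01; apply: filterS => q qP [qs _].
  by rewrite -[leRHS]mul1r qP.
near=> q.
have lin_q : `|dot g x - dot g q| <= e / 2 by near: q.
have close_q : `|x - q| <= e / 2 by near: q.
have rem_q : `|h q - h x - dot g (q - x)| <= `|q - x| by near: q.
have -> : h x - h q = - (h q - h x - dot g (q - x)) + (dot g x - dot g q).
  by rewrite dotBr; ring.
rewrite (le_trans (ler_normD _ _))// normrN [leRHS](splitr e) lerD//.
by rewrite (le_trans rem_q)// distrC.
Unshelve. all: by end_near.
Qed.

Lemma proximal_exists h gradh alpha eta g y : 0 < alpha -> C1_relint h gradh ->
  simplex_ge alpha y ->
  exists x, argmax (simplex_ge alpha) (fun p => eta * dot g p - bregman h gradh p y) x.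
Proof.
move=> alpha0 [grad _] yA.
have [] := @compact_EVT_max _ _ (fun p => eta * dot g p - bregman h gradh p y)
  (simplex_ge alpha).
- by exists y.
- exact: compact_simplex_ge.
- apply/subspace_continuousP => x xA.
  have hx := gradient_cvg alpha (grad x (simplex_ge_relint alpha0 xA)).
  have dx g' : dot g' q @[q --> within (simplex_ge alpha) (nbhs x)] --> dot g' x.
    by apply: cvg_dot; exact: cvg_within.
  rewrite /bregman; under eq_fun do rewrite dotBr.
  apply: cvgB; first by apply: cvgMr.
  apply: cvgB; first by apply: cvgB => //; exact: cvg_cst.
  by apply: cvgB => //; exact: cvg_cst.
- by move=> x /set_mem xA xmax; exists x; split=> // p pA; apply: xmax; rewrite inE.
Qed.

End Proximal.

(** * Clipped policy mirror ascent *)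

Section MirrorAscent.
Context {R : realType} {n m : nat}.
Variables (M : mdp R n m) (h : 'rV[R]_m -> R) (gradh : 'rV[R]_m -> 'rV[R]_m).
Hypotheses (h_convex : strictly_convex_on simplex_relint h) (h_C1 : C1_relint h gradh).
Variables (alpha eta : R) (mu : 'rV[R]_n).
Hypotheses (alpha01 : 0 < alpha <= 1) (eta_gt0 : 0 < eta) (mu_pos : simplex_pos mu).
Implicit Types pi : @policy R n m.

Let alpha_gt0 : 0 < alpha. Proof. by case/andP: alpha01. Qed.

Definition mirror_step pi pi1 := forall s,
  argmax (simplex_ge alpha)
    (fun p => eta * \sum_a Gval M pi s a * p 0 a - bregman h gradh p (pi s)) (pi1 s).

Let Grow pi s : 'rV[R]_m := \row_a Gval M pi s a.

Let objectiveE pi s :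
  (fun p : 'rV[R]_m => eta * \sum_a Gval M pi s a * p 0 a - bregman h gradh p (pi s)) =
  (fun p => eta * dot (Grow pi s) p - bregman h gradh p (pi s)).
Proof.
apply/funext => p; congr (_ * _ - _).
by apply: eq_bigr => a _; rewrite mxE.
Qed.

Lemma mirror_step_exists pi : policies_ge alpha pi -> exists pi1, mirror_step pi pi1.
Proof.
move=> ge; have /choice[pi1 pi1P] : forall s, exists x,
    argmax (simplex_ge alpha) (fun p => eta * \sum_a Gval M pi s a * p 0 a
      - bregman h gradh p (pi s)) x.
  move=> s; rewrite objectiveE.
  exact: proximal_exists.
by exists pi1.
Qed.

Lemma mirror_step_ge pi pi1 : mirror_step pi pi1 -> policies_ge alpha pi1.
Proof. by move=> st s; case: (st s). Qed.

Lemma mirror_step_three_point pi pi1 s p : mirror_step pi pi1 -> simplex_ge alpha p ->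
  eta * dot (Grow pi s) (p - pi1 s) <=
  bregman h gradh p (pi s) - bregman h gradh p (pi1 s) - bregman h gradh (pi1 s) (pi s).
Proof.
move=> /(_ s) + pA; rewrite objectiveE.
by move=> /proximal_three_point; apply.
Qed.

Let bregman_simplex_ge p q : simplex_ge alpha p -> simplex_ge alpha q ->
  0 <= bregman h gradh p q.
Proof.
by move=> pA qA; apply: bregman_ge0 => //; exact: simplex_ge_relint alpha_gt0 _.
Qed.

Let performance_dot pi pi' : policies_ge alpha pi -> policies_ge alpha pi' ->
  Jmu M mu pi' - Jmu M mu pi =
  \sum_s rho M mu pi' s * dot (Grow pi s) (pi' s - pi s).
Proof.
move=> ge ge'; rewrite performance_difference; try exact: policies_ge_pos alpha_gt0 _.
by apply: eq_bigr => s _; congr (_ * _); apply: eq_bigr => a _; rewrite !mxE.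
Qed.

(** The three-point inequality at p = pi s. *)
Lemma mirror_step_advantage_ge0 pi pi1 s : policies_ge alpha pi -> mirror_step pi pi1 ->
  0 <= dot (Grow pi s) (pi1 s - pi s).
Proof.
move=> ge st; have ge1 := mirror_step_ge st.
have := mirror_step_three_point s st (ge s).
have b0 : bregman h gradh (pi s) (pi s) = 0 by rewrite /bregman dotBr !subrr.
have b1 := bregman_simplex_ge (ge s) (ge1 s).
have b2 := bregman_simplex_ge (ge1 s) (ge s).
rewrite b0 !dotBr => three; rewrite -(pmulr_rge0 _ eta_gt0); lra.
Qed.

Lemma mirror_step_improves pi pi1 : policies_ge alpha pi -> mirror_step pi pi1 ->
  Jmu M mu pi <= Jmu M mu pi1.
Proof.
move=> ge st; rewrite -subr_ge0 performance_dot//; last exact: mirror_step_ge st.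
apply: sumr_ge0 => s _; rewrite mulr_ge0 ?mirror_step_advantage_ge0//.
exact: rho_ge0 alpha01 mu_pos (mirror_step_ge st).
Qed.

(** Compare pi' with pi through pi1. The advantage of pi1 over pi is weighted by
    rho pi', but it is nonnegative at each state, so Calpha turns that weight into
    rho pi1, which makes it the increase of Jmu; the advantage of pi' over pi1 is
    paid by the Bregman divergences. *)
Lemma mirror_step_gap pi pi1 pi' (D := bregman_weighted h gradh (rho M mu pi')) :
  policies_ge alpha pi -> mirror_step pi pi1 -> policies_ge alpha pi' ->
  Jmu M mu pi' - Jmu M mu pi <=
  Calpha M mu alpha * (Jmu M mu pi1 - Jmu M mu pi) + (D pi' pi - D pi' pi1) / eta.
Proof.
move=> ge st ge'; have ge1 := mirror_step_ge st.
rewrite !performance_dot// /D /bregman_weighted -sumrB mulr_suml mulr_sumr -big_split /=.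
apply: ler_sum => s _.
have adv := mirror_step_advantage_ge0 s ge st.
have three := mirror_step_three_point s st (ge' s).
have b2 := bregman_simplex_ge (ge1 s) (ge s).
have rho_s := rho_ge0 M s alpha01 mu_pos ge'.
have ratio := rho_ratio_le_Calpha M s alpha01 mu_pos ge' ge1.
have -> : dot (Grow pi s) (pi' s - pi s) =
    dot (Grow pi s) (pi1 s - pi s) + dot (Grow pi s) (pi' s - pi1 s).
  by rewrite !dotBr; ring.
rewrite mulrDr mulrA lerD ?ler_wpM2r//.
rewrite -mulrBr -mulrA ler_wpM2l// ler_pdivlMr// mulrC.
by apply: le_trans three _; rewrite gerBl.
Qed.

End MirrorAscent.

Theorem theorem9 (R : realType) (n m : nat) (M : mdp R n m)
    (h : 'rV[R]_m -> R) (gradh : 'rV[R]_m -> 'rV[R]_m)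
    (h_convex : strictly_convex_on simplex_relint h)
    (h_C1 : C1_relint h gradh)
    (alpha : R) (alpha_bounds : 0 < alpha < m%:R^-1)
    (mu : 'rV[R]_n) (mu_pos : simplex_pos mu)
    (eta : R) (eta_pos : 0 < eta)
    (pi0 : policy) (pi0_ge : policies_ge alpha pi0) :
  (exists pis : nat -> policy,
      clipped_mirror_ascent M h gradh alpha (fun _ => eta) pi0 pis) /\
  forall pis : nat -> policy,
    clipped_mirror_ascent M h gradh alpha (fun _ => eta) pi0 pis ->
    (forall k : nat, policies (pis k)) /\
    forall pi_alpha : policy,
      argmax (policies_ge alpha) (Jmu M mu) pi_alpha ->
      forall k : nat,
        Jmu M mu pi_alpha - Jmu M mu (pis k) <=
        k.+1%:R^-1 *
          (bregman_weighted h gradh (rho M mu pi_alpha) pi_alpha pi0 / eta +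
           Calpha M mu alpha * (Jmu M mu pi_alpha - Jmu M mu pi0)).
Proof.
have alpha_gt0 : 0 < alpha by case/andP: alpha_bounds.
have alpha01 : 0 < alpha <= 1.
  have /andP[_ alpha_lt] := alpha_bounds; rewrite alpha_gt0 /=.
  (* When m = 0 the bound m%:R^-1 is 0. *)
  apply: le_trans (ltW alpha_lt) _; case: (posnP m) => [->|m_gt0]; first by rewrite invr0 ler01.
  by rewrite invf_le1 ?ltr0n// ler1n.
split.
- have /choice[next nextP] : forall pi : @policy R n m, exists pi1 : @policy R n m,
      policies_ge alpha pi -> mirror_step M h gradh alpha eta pi pi1.
    move=> pi; have [ge|nge] := pselect (policies_ge alpha pi); last by exists pi.
    have [pi1 st] := mirror_step_exists M h_C1 eta alpha01 ge.
    by exists pi1.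
  exists (fun k => iter k next pi0); split=> // k.
  suff ge : policies_ge alpha (iter k next pi0) by exact: nextP.
  by elim: k => // k /nextP; exact: mirror_step_ge.
- move=> pis [pis0 pisS].
  have st k : mirror_step M h gradh alpha eta (pis k) (pis k.+1) by exact: pisS.
  have ge k : policies_ge alpha (pis k).
    by case: k => [|k]; [rewrite pis0|exact: mirror_step_ge (st k)].
  split=> [k|pi_alpha [opt_ge opt] k]; first by move=> s; have [] := ge k s.
  set J := Jmu M mu; set D := bregman_weighted h gradh (rho M mu pi_alpha) pi_alpha.
  set C := Calpha M mu alpha.
  have mono i j : (i <= j)%N -> J (pis i) <= J (pis j).
    apply: (homo_leq (f := fun i => J (pis i)) lexx le_trans) => l.
    by have := mirror_step_improves h_convex h_C1 alpha01 eta_pos mu_pos (ge l) (st l).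
  have telescope N : \sum_(i < N) (J pi_alpha - J (pis i)) <=
      C * (J (pis N) - J pi0) + (D pi0 - D (pis N)) / eta.
    elim: N => [|N IH]; first by rewrite big_ord0 pis0 !subrr mulr0 mul0r addr0.
    rewrite big_ord_recr /=.
    have gap := mirror_step_gap h_convex h_C1 alpha01 eta_pos mu_pos (ge N) (st N) opt_ge.
    apply: le_trans (lerD IH gap) _; rewrite -/C -/J -/D le_eqVlt.
    by apply/orP; left; apply/eqP; ring.
  have D_ge0 i : 0 <= D (pis i).
    apply: sumr_ge0 => s _; rewrite mulr_ge0 ?(rho_ge0 M _ alpha01 mu_pos opt_ge)//.
    apply: bregman_ge0 => //; first exact: simplex_ge_relint alpha_gt0 (opt_ge s).
    exact: simplex_ge_relint alpha_gt0 (ge i s).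
  rewrite ler_pdivlMl ?ltr0n// mulr_natl.
  apply: (@le_trans _ _ (\sum_(i < k.+1) (J pi_alpha - J (pis i)))).
    rewrite -[in leLHS](card_ord k.+1) -sumr_const; apply: ler_sum => i _.
    by rewrite lerD2l lerN2 mono// -ltnS.
  apply: le_trans (telescope k.+1) _; rewrite addrC lerD//.
    by rewrite ler_wpM2r ?invr_ge0 ?(ltW eta_pos)// gerBl.
  rewrite ler_wpM2l ?(Calpha_ge0 M alpha01 mu_pos pi0_ge)// lerD2r.
  exact: opt.
Qed.
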